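(* Let $M^n$ be a compact manifold and let $(g(t),\varphi(t))$ be a solution on $M^n$, starting at $t=0$, of the rescaled List's extended Ricci flow $$\frac{\partial}{\partial t}g_{ij}=-2\left(S_{ij}-\frac{r}{n}g_{ij}\right),\qquad \varphi_t=\Delta\varphi,$$ where $r=r(t)$ is a function depending only on $t$. Then the nonnegativity of $S$ is preserved along the flow: if $S\ge0$ on $M$ at $t=0$, then $S\ge0$ on $M$ for all $t\ge 0$ for which the solution exists.
   Context: $M^n$ is a compact $n$-dimensional manifold (without boundary); $g(t)$ is a smooth family of Riemannian metrics and $\varphi=\varphi(t)$ a smooth family of real functions on $M$; $\alpha>0$ is a fixed real constant. $\Delta$, $\nabla$ are the Laplacian and gradient of $g(t)$; $R_{ij}$ is the Ricci tensor, $R$ the scalar curvature, $\varphi_i=\nabla_i\varphi$. Define $S_{ij}=R_{ij}-\alpha\varphi_i\varphi_j$ and $S=g^{ij}S_{ij}=R-\alpha|\nabla\varphi|^2$. *)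

(* Defs.v *)
From mathcomp Require Import all_boot all_order all_algebra.
From mathcomp Require Import all_classical all_reals all_analysis.

Set Implicit Arguments.
Unset Strict Implicit.
Unset Printing Implicit Defensive.

Import Order.TTheory GRing.Theory Num.Theory.
Import numFieldNormedType.Exports.

Local Open Scope classical_set_scope.
Local Open Scope ring_scope.

(** C^oo is expressed through iterated coordinate
    partial derivatives of every order and in every sequence of directions: all
    of them exist and are continuous. *)

Definition pderiv (R : realType) (n : nat) (k : 'I_n) (f : 'rV[R]_n -> R)
  (x : 'rV[R]_n) : R := 'D_('e_k) f x.

Definition smooth_on (R : realType) (n : nat) (D : set 'rV[R]_n)
    (f : 'rV[R]_n -> R) : Prop :=
  forall (s : seq 'I_n) (x : 'rV[R]_n), D x ->
    {for x, continuous (foldr (@pderiv R n) f s)} /\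
    forall k : 'I_n, derivable (foldr (@pderiv R n) f s) x 'e_k.

(** The time derivative is taken within the time interval [J], so that it is
    one-sided at an endpoint of [J] belonging to [J]. *)

Definition tderiv (R : realType) (J : set R) (f : R -> R) (t : R) : R :=
  lim ((f s - f t) / (s - t) @[s --> within J t^']).

Definition tderivable (R : realType) (J : set R) (f : R -> R) (t : R) : Prop :=
  cvg ((f s - f t) / (s - t) @[s --> within J t^']).

(** Derivatives of functions of (t, x): the direction [None] is time, and
    [Some k] is the [k]-th space coordinate. *)

Definition stderiv (R : realType) (n : nat) (J : set R) (d : option 'I_n)
    (F : R -> 'rV[R]_n -> R) : R -> 'rV[R]_n -> R :=
  match d with
  | None => fun t x => tderiv J (fun s => F s x) t
  | Some k => fun t => pderiv k (F t)
  end.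

Definition stderivable (R : realType) (n : nat) (J : set R) (d : option 'I_n)
    (F : R -> 'rV[R]_n -> R) (t : R) (x : 'rV[R]_n) : Prop :=
  match d with
  | None => tderivable J (fun s => F s x) t
  | Some k => derivable (F t) x 'e_k
  end.

Definition smooth_family_on (R : realType) (n : nat) (J : set R)
    (D : set 'rV[R]_n) (F : R -> 'rV[R]_n -> R) : Prop :=
  forall s : seq (option 'I_n),
    {within J `*` D,
      continuous (fun p => foldr (@stderiv R n J) F s p.1 p.2)} /\
    forall (d : option 'I_n) (t : R) (x : 'rV[R]_n), J t -> D x ->
      stderivable J d (foldr (@stderiv R n J) F s) t x.

(** A smooth structure without boundary on [M], given by an atlas that need not
    be maximal. [chart_inv i] is only meaningful on the image of [chart i]. *)

Record smooth_manifold (R : realType) (n : nat) (M : topologicalType) := {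
  chart_index : Type;
  chart_dom : chart_index -> set M;
  chart : chart_index -> M -> 'rV[R]_n;
  chart_inv : chart_index -> 'rV[R]_n -> M;
  manifold_hausdorff : hausdorff_space M;
  manifold_second_countable : @second_countable M;
  chart_dom_open : forall i, open (chart_dom i);
  chart_img_open : forall i, open (chart i @` chart_dom i);
  chart_continuous : forall i, {within chart_dom i, continuous (chart i)};
  chart_inv_continuous : forall i,
    {within chart i @` chart_dom i, continuous (chart_inv i)};
  chartK : forall i p, chart_dom i p -> chart_inv i (chart i p) = p;
  chart_cover : forall p : M, exists i, chart_dom i p;
  transition_smooth : forall (i j : chart_index) (k : 'I_n),
    smooth_on (chart i @` (chart_dom i `&` chart_dom j))
      (fun x => chart j (chart_inv i x) 0 k)
}.

Definition chart_img (R : realType) (n : nat) (M : topologicalType)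
    (A : smooth_manifold R n M) (i : chart_index A) : set 'rV[R]_n :=
  chart i @` chart_dom i.

Definition smooth_scalar_family (R : realType) (n : nat) (M : topologicalType)
    (A : smooth_manifold R n M) (J : set R) (phi : R -> M -> R) : Prop :=
  forall i : chart_index A,
    smooth_family_on J (chart_img i) (fun t x => phi t (chart_inv i x)).

(** A smooth family, indexed by [t] in [J], of Riemannian metrics, given by
    its components [metric i t x a b] = g_ab(t) in each chart [i]. *)

Record metric_family (R : realType) (n : nat) (M : topologicalType)
    (A : smooth_manifold R n M) (J : set R) := {
  metric :> chart_index A -> R -> 'rV[R]_n -> 'M[R]_n;
  metric_smooth : forall (i : chart_index A) (a b : 'I_n),
    smooth_family_on J (chart_img i) (fun t x => metric i t x a b);
  metric_sym : forall (i : chart_index A) t x, J t -> chart_img i x ->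
    (metric i t x)^T = metric i t x;
  metric_posdef : forall (i : chart_index A) t x, J t -> chart_img i x ->
    forall v : 'rV[R]_n, v != 0 -> 0 < (v *m metric i t x *m v^T) 0 0;
  metric_tensorial : forall (i j : chart_index A) t p,
    J t -> chart_dom i p -> chart_dom j p -> forall a b : 'I_n,
    metric i t (chart i p) a b =
      \sum_(c < n) \sum_(d < n)
        pderiv a (fun y => chart j (chart_inv i y) 0 c) (chart i p) *
        pderiv b (fun y => chart j (chart_inv i y) 0 d) (chart i p) *
        metric j t (chart j p) c d
}.

(** [christoffel g k i j] is Gamma^k_ij. *)
Definition christoffel (R : realType) (n : nat) (g : 'rV[R]_n -> 'M[R]_n)
    (k i j : 'I_n) (x : 'rV[R]_n) : R :=
  2^-1 * \sum_(l < n) invmx (g x) k l *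
    (pderiv i (fun y => g y j l) x + pderiv j (fun y => g y i l) x
     - pderiv l (fun y => g y i j) x).

(** [riemann g l i j k] is R^l_ijk, where
    R(d_i, d_j) d_k = nabla_i nabla_j d_k - nabla_j nabla_i d_k
                    = \sum_l R^l_ijk d_l. *)
Definition riemann (R : realType) (n : nat) (g : 'rV[R]_n -> 'M[R]_n)
    (l i j k : 'I_n) (x : 'rV[R]_n) : R :=
  pderiv i (christoffel g l j k) x - pderiv j (christoffel g l i k) x
  + \sum_(m < n) (christoffel g m j k x * christoffel g l i m x
                  - christoffel g m i k x * christoffel g l j m x).

(** With this contraction round spheres have positive Ricci curvature. *)
Definition ricci (R : realType) (n : nat) (g : 'rV[R]_n -> 'M[R]_n)
    (j k : 'I_n) (x : 'rV[R]_n) : R :=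
  \sum_(i < n) riemann g i i j k x.

Definition laplacian (R : realType) (n : nat) (g : 'rV[R]_n -> 'M[R]_n)
    (u : 'rV[R]_n -> R) (x : 'rV[R]_n) : R :=
  \sum_(i < n) \sum_(j < n) invmx (g x) i j *
    (pderiv i (pderiv j u) x
     - \sum_(k < n) christoffel g k i j x * pderiv k u x).

(** S_ij = R_ij - alpha phi_i phi_j and S = g^ij S_ij. *)
Definition List_tensor (R : realType) (n : nat) (alpha : R)
    (g : 'rV[R]_n -> 'M[R]_n) (u : 'rV[R]_n -> R) (i j : 'I_n)
    (x : 'rV[R]_n) : R :=
  ricci g i j x - alpha * pderiv i u x * pderiv j u x.

Definition List_scalar (R : realType) (n : nat) (alpha : R)
    (g : 'rV[R]_n -> 'M[R]_n) (u : 'rV[R]_n -> R) (x : 'rV[R]_n) : R :=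
  \sum_(i < n) \sum_(j < n) invmx (g x) i j * List_tensor alpha g u i j x.

Definition rescaled_List_flow (R : realType) (n : nat) (M : topologicalType)
    (A : smooth_manifold R n M) (J : set R) (alpha : R) (r : R -> R)
    (g : metric_family A J) (phi : R -> M -> R) : Prop :=
  forall (i : chart_index A) (t : R) (x : 'rV[R]_n), J t -> chart_img i x ->
    (forall a b : 'I_n,
      tderiv J (fun s => g i s x a b) t =
        - 2 * (List_tensor alpha (g i t) (fun y => phi t (chart_inv i y)) a b x
               - r t / n%:R * g i t x a b)) /\
    tderiv J (fun s => phi s (chart_inv i x)) t =
      laplacian (g i t) (fun y => phi t (chart_inv i y)) x.

(** [S] is a scalar, so its value at [p] is the same in every chart around [p]. *)
Definition List_scalar_nonneg (R : realType) (n : nat) (M : topologicalType)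
    (A : smooth_manifold R n M) (J : set R) (alpha : R)
    (g : metric_family A J) (phi : R -> M -> R) (t : R) : Prop :=
  forall (i : chart_index A) (p : M), chart_dom i p ->
    0 <= List_scalar alpha (g i t) (fun y => phi t (chart_inv i y)) (chart i p).

(* Main.v *)
Require Import Defs.
From HB Require Import structures.
From mathcomp Require Import all_boot all_order all_algebra.
From mathcomp Require Import all_classical all_reals all_analysis.
From mathcomp Require Import ring lra.
Set Implicit Arguments.
Unset Strict Implicit.
Unset Printing Implicit Defensive.
Import Order.TTheory GRing.Theory Num.Theory.
Import numFieldNormedType.Exports.
Local Open Scope classical_set_scope.
Local Open Scope ring_scope.

(** Why the nonnegativity of S survives.  Along the flow S satisfies

      d/dt S = Lap S + 2 |S_ij|^2 + 2 alpha (Lap phi)^2 - (2 r / n) S,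

    so d/dt S >= Lap S - (2 r / n) S, and the minimum principle applies: if S
    were negative somewhere on [0, t1] x M, the function exp (- L t) S would
    have a negative minimum over this compact set, at a time t0 > 0.  There
    Lap S >= 0 and the time derivative from the left is nonpositive, which is
    impossible once L + 2 r / n > 0 on [0, t1].  Since r is determined by the
    continuous function S and by the trace of dg/dt, it is bounded on [0, t1],
    and such an L exists.

    The evolution equation is an identity between polynomials in the partial
    derivatives of g, of its inverse and of phi.  It is proved in an arbitrary
    commutative ring with commuting derivations d_t, d_1, ..., d_n, and then
    read in the ring of smooth functions of (t, x) on J x (chart image).  With
    h = dg/dt and the connection matrices Gamma_i, the variation of curvature
    is d_t F_ij = D_i (d_t Gamma_j) - D_j (d_t Gamma_i); its trace is a
    divergence (contract_variation), whence

      d_t R = - <h, Ric> + div V,   V = div h - grad tr h.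

    The second Bianchi identity has the same shape with d_t replaced by d_a,
    so the same lemma gives the contracted identity dR = 2 div Ric.  For
    h = - 2 S_ij + (2 r / n) g this leads to V = grad S + 2 alpha (Lap phi)
    grad phi, and the terms <grad phi, grad Lap phi> coming from div V and from
    d_t |grad phi|^2 cancel (dt_List_trace).

    That S is a function on M, the same in all charts, follows from the flow
    equation, which gives tr (g^-1 dg/dt) = - 2 S + 2 r: the derivative dg/dt
    transforms as a tensor because g does, for every t, with time-independent
    Jacobians (S_chart_independent).

    The analysis behind the ring of smooth functions consists of the closure of
    smoothness under ring operations and inversion (smooth_closure_smooth) and
    of the symmetry of mixed partial derivatives, including the one-sided time
    derivative at an end of J (stderivC). *)

(** * Derivations on matrices over a commutative ring *)

Lemma sum_swap23 (K : pzSemiRingType) n (f : 'I_n -> 'I_n -> 'I_n -> K) :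
  \sum_i \sum_j \sum_k f i j k = \sum_i \sum_k \sum_j f i j k.
Proof. by apply: eq_bigr => i _; rewrite exchange_big. Qed.

Lemma sum_swap34 (K : pzSemiRingType) n (f : 'I_n -> 'I_n -> 'I_n -> 'I_n -> K) :
  \sum_i \sum_j \sum_k \sum_m f i j k m = \sum_i \sum_j \sum_m \sum_k f i j k m.
Proof. by apply: eq_bigr => i _; rewrite sum_swap23. Qed.

(** Distributes products over sums at every depth, so that both sides of an index
    identity become iterated sums of monomials, to be matched after a permutation
    of the summation indices. *)
Ltac expand_sums := repeat first [rewrite mulr_suml | rewrite mulr_sumr];
   try (under eq_bigr => ? _ do expand_sums).
Ltac expand_lhs := under [LHS]eq_bigr => ? _ do expand_sums.
Ltac expand_rhs := under [RHS]eq_bigr => ? _ do expand_sums.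

Section MatrixDerivation.
Variables (K : comPzRingType) (n : nat) (d : {additive K -> K}).
Hypothesis dM : forall x y, d (x * y) = d x * y + x * d y.

Lemma derivation1 : d 1 = 0.
Proof.
have := dM 1 1; rewrite !mul1r mulr1 => /(congr1 (fun z => z - d 1)).
by rewrite subrr addrK.
Qed.

Lemma map_mx_derivationM (A B : 'M[K]_n) :
  map_mx d (A *m B) = map_mx d A *m B + A *m map_mx d B.
Proof.
apply/matrixP => i j; rewrite !mxE raddf_sum -big_split /=.
by apply: eq_bigr => k _; rewrite dM !mxE.
Qed.

Lemma map_mx_derivation_scalar1 : map_mx d (1%:M : 'M[K]_n) = 0.
Proof.
apply/matrixP => i j; rewrite !mxE.
by case: eqP => _; rewrite ?mulr1n ?mulr0n ?derivation1 ?raddf0.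
Qed.

Lemma map_mx_derivation_inv (P G : 'M[K]_n) : P *m G = 1%:M -> G *m P = 1%:M ->
  map_mx d P = - (P *m map_mx d G *m P).
Proof.
move=> PG GP.
have := map_mx_derivation_scalar1; rewrite -{1}PG map_mx_derivationM.
move=> /(congr1 (fun X => X *m P)); rewrite mul0mx mulmxDl -mulmxA GP mulmx1.
by move/eqP; rewrite addr_eq0 => /eqP.
Qed.

End MatrixDerivation.

(** Proves identities that hold in the additive group of matrices once each product
    is treated as an atom. *)
Ltac matrix_ac :=
  repeat match goal with
    |- context [@mulmx ?R ?m ?n ?p ?A ?B] => move: (@mulmx R m n p A B) => ?
  end;
  repeat match goal with
    |- context [@map_mx ?aT ?rT ?f ?m ?n ?B] => move: (@map_mx aT rT f m n B) => ?
  end;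
  apply/matrixP => ? ?; rewrite !mxE; ring.

Lemma trmxD (K : nmodType) m n (A B : 'M[K]_(m, n)) : (A + B)^T = A^T + B^T.
Proof. by apply/matrixP => i j; rewrite !mxE. Qed.

Lemma trmxN (K : zmodType) m n (A : 'M[K]_(m, n)) : (- A)^T = - A^T.
Proof. by apply/matrixP => i j; rewrite !mxE. Qed.

Lemma mxtraceN (K : pzRingType) m (A : 'M[K]_m) : \tr (- A) = - \tr A.
Proof. by rewrite -sumrN; apply: eq_bigr => i _; rewrite mxE. Qed.

Lemma oppmxE (K : zmodType) m n (A : 'M[K]_(m, n)) i j : (- A) i j = - A i j.
Proof. by rewrite mxE. Qed.

(** * Connections and curvature over a differential ring *)

(** [d None] is the time derivative and [d (Some i)] the i-th partial derivative;
    [G] is the metric, [P] its inverse and [Gam i] the matrix of Gamma^a_ib, with row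
    index a and column index b.  The connection is characterized by torsion-freeness
    and metric compatibility. *)
Section Connection.
Variables (K : comPzRingType) (n : nat).
Variable d : option 'I_n -> {additive K -> K}.
Hypothesis dM : forall e x y, d e (x * y) = d e x * y + x * d e y.
Hypothesis dC : forall e e' x, d e (d e' x) = d e' (d e x).
Variables (G P : 'M[K]_n) (Gam : 'I_n -> 'M[K]_n).
Hypothesis PG : P *m G = 1%:M.
Hypothesis GP : G *m P = 1%:M.
Hypothesis Gsym : G^T = G.
Hypothesis torsion_free : forall i a b, Gam i a b = Gam b a i.
Hypothesis metric_compat :
  forall i, map_mx (d (Some i)) G = (Gam i)^T *m G + G *m Gam i.

Lemma map_mx_derivC e e' (A : 'M[K]_n) : 
  map_mx (d e) (map_mx (d e') A) = map_mx (d e') (map_mx (d e) A).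
Proof. by apply/matrixP => a b; rewrite !mxE dC. Qed.

Lemma inverse_metric_sym : P^T = P.
Proof.
have : P^T *m G = 1%:M by rewrite -{1}Gsym -trmx_mul GP trmx1.
by move=> /(congr1 (mulmx^~ P)); rewrite -mulmxA GP mulmx1 mul1mx.
Qed.

Lemma inverse_metric_symE a b : P a b = P b a.
Proof. by rewrite -{1}inverse_metric_sym mxE. Qed.

Lemma raise_lower (w : 'I_n -> K) i : \sum_k P i k * \sum_m G k m * w m = w i.
Proof.
transitivity (\sum_m (P *m G) i m * w m).
  under [RHS]eq_bigr do rewrite mxE.
  by expand_lhs; expand_rhs; rewrite exchange_big; do 2!apply: eq_bigr => ? _; ring.
rewrite PG (bigD1 i) //= mxE eqxx mul1r big1 ?addr0 // => m mi.
by rewrite mxE eq_sym (negbTE mi) mul0r.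
Qed.

Lemma deriv_inverse_metric i : map_mx (d (Some i)) P = - (Gam i *m P) - P *m (Gam i)^T.
Proof.
rewrite (map_mx_derivation_inv (dM (Some i)) PG GP) metric_compat mulmxDr mulmxDl.
rewrite !mulmxA PG mul1mx -[P *m _ *m G *m P]mulmxA GP mulmx1 opprD addrC.
by [].
Qed.

Lemma deriv_inverse_metricE i a b : d (Some i) (P a b) =
  - (\sum_m Gam i a m * P m b) - \sum_m P a m * Gam i b m.
Proof.
have := congr1 (fun X : 'M[K]_n => X a b) (deriv_inverse_metric i); rewrite !mxE => ->.
by congr (_ - _); apply: eq_bigr => m _; rewrite mxE.
Qed.

(** The trace of [Gam i] is Gamma^m_im, so this is the covariant divergence of a
    vector field. *)
Definition divergence (V : 'I_n -> K) : K :=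
  \sum_i (d (Some i) (V i) + \tr (Gam i) * V i).

Definition curvature i j : 'M[K]_n :=
  map_mx (d (Some i)) (Gam j) - map_mx (d (Some j)) (Gam i)
  + (Gam i *m Gam j - Gam j *m Gam i).

Lemma curvatureE i j l k : curvature i j l k =
  d (Some i) (Gam j l k) - d (Some j) (Gam i l k)
  + \sum_m (Gam j m k * Gam i l m - Gam i m k * Gam j l m).
Proof.
rewrite !mxE -sumrB; congr (_ + _); apply: eq_bigr => m _; ring.
Qed.

(** Only the endomorphism indices are corrected by the connection, not the form
    index that [X] may carry.  After antisymmetrization in two form indices the missing
    terms cancel, because the connection is torsion free. *)
Definition covd i (X : 'M[K]_n) : 'M[K]_n :=
  map_mx (d (Some i)) X + (Gam i *m X - X *m Gam i).

Lemma divergenceD V W : divergence (fun i => V i + W i) = divergence V + divergence W.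
Proof.
by rewrite -big_split; apply: eq_bigr => i _; rewrite raddfD mulrDr /= addrACA.
Qed.

Lemma divergenceN V : divergence (fun i => - V i) = - divergence V.
Proof.
by rewrite -sumrN; apply: eq_bigr => i _; rewrite raddfN mulrN /= opprD.
Qed.

Lemma divergenceM f V : divergence (fun i => f * V i) =
  f * divergence V + \sum_i d (Some i) f * V i.
Proof.
rewrite mulr_sumr -big_split; apply: eq_bigr => i _; rewrite dM /=.
ring.
Qed.

Lemma eq_divergence V W : V =1 W -> divergence V = divergence W.
Proof. by move=> e; apply: eq_bigr => i _; rewrite e. Qed.

Lemma trace_connectionE i : \tr (Gam i) = \sum_m Gam m m i.
Proof. by rewrite /mxtrace; apply: eq_bigr => m _; rewrite torsion_free. Qed.

Lemma divergence_raise (c : 'I_n -> K) :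
  divergence (fun i => \sum_k P i k * c k) =
  \sum_j \sum_k P j k * (d (Some j) (c k) - \sum_m Gam j m k * c m).
Proof.
transitivity (\sum_i \sum_k (P i k * d (Some i) (c k)
   - (\sum_m Gam i i m * P m k) * c k
   - (\sum_m P i m * Gam i k m) * c k
   + (\sum_m Gam m m i) * P i k * c k)).
  apply: eq_bigr => i _; rewrite raddf_sum trace_connectionE mulr_sumr -big_split.
  by apply: eq_bigr => k _ /=; rewrite dM deriv_inverse_metricE; ring.
have e1 : \sum_i \sum_k (\sum_m Gam m m i) * P i k * c k =
      \sum_i \sum_k (\sum_m Gam i i m * P m k) * c k.
  expand_lhs; expand_rhs.
  rewrite sum_swap23 exchange_big sum_swap23 /=.
  by do 3!apply: eq_bigr => ? _; ring.
have e2 : \sum_j \sum_k P j k * \sum_m Gam j m k * c m =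
   \sum_i \sum_k (\sum_m P i m * Gam i k m) * c k.
  expand_lhs; expand_rhs.
  by rewrite sum_swap23; do 3!apply: eq_bigr => ? _; ring.
under eq_bigr do rewrite big_split !sumrB /=.
rewrite big_split !sumrB /= e1 -e2.
under [in RHS]eq_bigr do under eq_bigr do rewrite mulrBr.
under [in RHS]eq_bigr do rewrite sumrB.
rewrite sumrB; ring.
Qed.

Section DivergenceOfVariation.
Variable C : 'I_n -> 'M[K]_n.

(** The last term is the correction for the form index that [covd] leaves out.  It
    reappears in [contract_covd_trace] and cancels in the difference. *)
Lemma contract_covd_raise :
  \sum_i \sum_j \sum_k P j k * covd i (C j) i k =
  divergence (fun i => \sum_j \sum_k P j k * C j i k)
  + \sum_j \sum_k P j k * \sum_i \sum_m Gam i m j * C m i k.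
Proof.
pose X := \sum_i \sum_j \sum_k P j k * d (Some i) (C j i k).
pose A1 := \sum_i \sum_j \sum_k (\sum_m Gam i j m * P m k) * C j i k.
pose A2 := \sum_i \sum_j \sum_k (\sum_m P j m * Gam i k m) * C j i k.
pose B := \sum_i \sum_j \sum_k (\sum_m Gam m m i) * P j k * C j i k.
have -> : divergence (fun i => \sum_j \sum_k P j k * C j i k) = X - A1 - A2 + B.
  rewrite /X /A1 /A2 /B -!sumrB -big_split; apply: eq_bigr => i _ /=.
  rewrite raddf_sum mulr_sumr -!sumrB -!big_split; apply: eq_bigr => j _ /=.
  rewrite raddf_sum mulr_sumr -!sumrB -!big_split; apply: eq_bigr => k _ /=.
  by rewrite dM deriv_inverse_metricE trace_connectionE; ring.
have -> : \sum_j \sum_k P j k * \sum_i \sum_m Gam i m j * C m i k = A1.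
  rewrite /A1; expand_lhs; expand_rhs.
  (* the summation order (j,k,i,m) becomes (i,m,k,j) *)
  rewrite exchange_big sum_swap23 exchange_big sum_swap34 sum_swap23 /=.
  by do 4!apply: eq_bigr => ? _; ring.
have -> : \sum_i \sum_j \sum_k P j k * covd i (C j) i k =
  X + \sum_i \sum_j \sum_k P j k * (\sum_m Gam i i m * C j m k)
    - \sum_i \sum_j \sum_k P j k * (\sum_m C j i m * Gam i m k).
  rewrite /X -big_split -sumrB; apply: eq_bigr => i _ /=.
  rewrite -big_split -sumrB; apply: eq_bigr => j _ /=.
  rewrite -big_split -sumrB; apply: eq_bigr => k _ /=.
  by rewrite !mxE; ring.
have -> : \sum_i \sum_j \sum_k P j k * (\sum_m Gam i i m * C j m k) = B.
  rewrite /B; expand_lhs; expand_rhs.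
  (* the summation order (i,j,k,m) becomes (m,j,k,i) *)
  rewrite sum_swap34 sum_swap23 exchange_big sum_swap23 sum_swap34 /=.
  by do 4!apply: eq_bigr => ? _; ring.
have -> : \sum_i \sum_j \sum_k P j k * (\sum_m C j i m * Gam i m k) = A2.
  rewrite /A2; expand_lhs; expand_rhs.
  by rewrite sum_swap34; do 4!apply: eq_bigr => ? _; ring.
ring.
Qed.

Lemma contract_covd_trace :
  \sum_i \sum_j \sum_k P j k * covd j (C i) i k =
  divergence (fun i => \sum_k P i k * \sum_l C l l k)
  + \sum_j \sum_k P j k * \sum_i \sum_m Gam i m j * C m i k.
Proof.
rewrite divergence_raise exchange_big /= -big_split; apply: eq_bigr => j _ /=.
rewrite exchange_big /= -big_split; apply: eq_bigr => k _ /=.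
rewrite -mulr_sumr -mulrDr; congr (_ * _).
rewrite raddf_sum /=.
have -> : \sum_i \sum_m Gam i m j * C m i k = \sum_i \sum_m Gam j i m * C i m k.
  rewrite exchange_big; do 2!apply: eq_bigr => ? _.
  by rewrite (torsion_free j).
have -> : \sum_m Gam j m k * (\sum_l C l l m) = \sum_i \sum_m C i i m * Gam j m k.
  by expand_lhs; rewrite exchange_big; do 2!apply: eq_bigr => ? _; ring.
rewrite addrAC -sumrN -!big_split; apply: eq_bigr => i _ /=.
by rewrite !mxE; ring.
Qed.

(** V^i = g^jk C^i_jk - g^ik C^l_lk for a variation C of the connection. *)
Definition variation_field i :=
  \sum_j \sum_k P j k * C j i k - \sum_k P i k * \sum_l C l l k.

(** The contraction of the Palatini formula.  It is applied to the time derivative of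
    the connection and, through the second Bianchi identity, to the family C_j = F_aj of
    curvature matrices. *)
Lemma contract_variation :
  \sum_i \sum_j \sum_k P j k * (covd i (C j) - covd j (C i)) i k =
  divergence variation_field.
Proof.
rewrite divergenceD divergenceN -[RHS](addrKA (\sum_j \sum_k P j k * \sum_i \sum_m Gam i m j *
  C m i k)).
rewrite -contract_covd_raise [_ + divergence _]addrC -contract_covd_trace -sumrB.
by do 3!(rewrite -?sumrB; apply: eq_bigr => ? _); rewrite !mxE; ring.
Qed.

End DivergenceOfVariation.

Lemma curvature_antisym i j : curvature j i = - curvature i j.
Proof. by rewrite /curvature; matrix_ac. Qed.

(** The two second derivatives d_i d_j G and d_j d_i G of the metric agree, and their
    difference expands by metric compatibility to this expression. *)
Lemma curvature_lower_antisym i j :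
  (curvature i j)^T *m G + G *m curvature i j = 0.
Proof.
have := map_mx_derivC (Some i) (Some j) G.
rewrite !metric_compat !map_mxD !(map_mx_derivationM (dM _)) -!map_trmx !metric_compat.
rewrite /curvature !(trmxD, trmxN, trmx_mul).
rewrite !(mulmxDr, mulmxDl, mulNmx, mulmxN) !mulmxA => /eqP.
by rewrite -subr_eq0 => /eqP <-; matrix_ac.
Qed.

Lemma curvature_raise_antisym i j a b :
  (curvature i j *m P) b a = - (curvature i j *m P) a b.
Proof.
have : curvature i j *m P + P *m (curvature i j)^T = 0.
  have := congr1 (fun X => P *m X *m P) (curvature_lower_antisym i j).
  rewrite /= mulmx0 mul0mx mulmxDr mulmxDl !mulmxA PG mul1mx.
  by rewrite -[_ *m G *m P]mulmxA GP mulmx1 addrC.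
rewrite -{2}inverse_metric_sym -trmx_mul => /(congr1 (fun X : 'M[K]_n => X b a)).
by rewrite !mxE => /eqP; rewrite addr_eq0 => /eqP ->.
Qed.

Lemma second_bianchi a i j : covd a (curvature i j) = covd i (curvature a j) - covd j
  (curvature a i).
Proof.
rewrite /covd /curvature !map_mxD !map_mxN !(map_mx_derivationM (dM _)).
rewrite !(map_mx_derivC (Some i) (Some a)) !(map_mx_derivC (Some j) (Some a)) !(map_mx_derivC
  (Some j) (Some i)).
rewrite !(mulmxDr, mulmxDl, mulNmx, mulmxN) !mulmxA.
matrix_ac.
Qed.

Lemma dt_curvature i j : map_mx (d None) (curvature i j) =
  covd i (map_mx (d None) (Gam j)) - covd j (map_mx (d None) (Gam i)).
Proof.
rewrite /covd /curvature !map_mxD !map_mxN !(map_mx_derivationM (dM _)).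
rewrite !(map_mx_derivC None).
matrix_ac.
Qed.

Definition ricci_form : 'M[K]_n := \matrix_(j, k) \sum_i curvature i j i k.
Definition scalar_curvature : K := \sum_j \sum_k P j k * ricci_form j k.
Definition ricci_raised a i : K := \sum_m P i m * ricci_form a m.

Lemma scalar_curvatureE : scalar_curvature = \sum_i \sum_j \sum_k P j k * curvature i j i k.
Proof.
rewrite exchange_big; apply: eq_bigr => j _; rewrite exchange_big.
by apply: eq_bigr => k _; rewrite mxE mulr_sumr.
Qed.

Section TimeDerivative.
Let H := map_mx (d None) G.

Lemma dt_inverse_metric a b : d None (P a b) = - (P *m H *m P) a b.
Proof.
have := congr1 (fun X : 'M[K]_n => X a b) (map_mx_derivation_inv (dM None) PG GP).
by rewrite !mxE.
Qed.

Lemma dt_scalar_curvature : d None scalar_curvature =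
  - (\sum_j \sum_k (P *m H *m P) j k * ricci_form j k)
  + divergence (variation_field (fun i => map_mx (d None) (Gam i))).
Proof.
rewrite -contract_variation.
have -> : \sum_j \sum_k (P *m H *m P) j k * ricci_form j k =
  \sum_i \sum_j \sum_k (P *m H *m P) j k * curvature i j i k.
  rewrite [RHS]exchange_big; apply: eq_bigr => j _; rewrite [RHS]exchange_big.
  by apply: eq_bigr => k _; rewrite [ricci_form _ _]mxE mulr_sumr.
rewrite scalar_curvatureE raddf_sum -sumrN -big_split; apply: eq_bigr => i _ /=.
rewrite raddf_sum -sumrN -big_split; apply: eq_bigr => j _ /=.
rewrite raddf_sum -sumrN -big_split; apply: eq_bigr => k _ /=.
by rewrite -dt_curvature dM dt_inverse_metric [in X in _ = _ + X]mxE; ring.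
Qed.

Definition covd_form i (B : 'M[K]_n) : 'M[K]_n :=
  map_mx (d (Some i)) B - ((Gam i)^T *m B + B *m Gam i).

Definition div_form (B : 'M[K]_n) k : K := \sum_i \sum_j P i j * covd_form i B k j.

Lemma covd_form_metric i : covd_form i G = 0.
Proof. by rewrite /covd_form metric_compat subrr. Qed.

(** The time derivative of metric compatibility.  Its two contractions determine the
    traces of the variation of the connection without solving for it. *)
Lemma covd_form_dt_metric i : let C := map_mx (d None) (Gam i) in
  covd_form i H = C^T *m G + G *m C.
Proof.
rewrite /= /covd_form /H map_mx_derivC metric_compat map_mxD !(map_mx_derivationM (dM _)) -map_trmx.
matrix_ac.
Qed.

Lemma trace_covd_form i (B : 'M[K]_n) : \tr (P *m covd_form i B) = d (Some i) (\tr (P *m B)).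
Proof.
have -> : d (Some i) (\tr (P *m B)) = \tr (map_mx (d (Some i)) (P *m B)).
  by rewrite /mxtrace raddf_sum; apply: eq_bigr => a _; rewrite !mxE.
rewrite (map_mx_derivationM (dM _)) deriv_inverse_metric /covd_form mulmxBr mulmxDr mulmxDl.
rewrite !mulNmx !(mxtraceD, mxtraceN) !mulmxA.
rewrite [\tr (P *m B *m Gam i)]mxtrace_mulC mulmxA; ring.
Qed.

(** Contracting [covd_form_dt_metric] once with the pair of connection indices gives
    2 tr C_k = d_k tr h, and once with a mixed pair gives g W = div h - tr C, where
    W^m = g^ij C^m_ij. *)
Lemma variation_field_dt i :
  variation_field (fun i => map_mx (d None) (Gam i)) i =
  \sum_k P i k * (div_form H k - d (Some k) (\tr (P *m H))).
Proof.
pose C i := map_mx (d None) (Gam i).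
pose W m := \sum_j \sum_k P j k * C j m k.
pose c k := \sum_l C l l k.
have Csym a b e : C a b e = C e b a by rewrite !mxE torsion_free.
have trC k : d (Some k) (\tr (P *m H)) = 2 * c k.
  rewrite -trace_covd_form covd_form_dt_metric mulmxDr mxtraceD !mulmxA PG mul1mx.
  rewrite mxtrace_mulC !mulmxA GP mul1mx mxtrace_tr.
  have -> : c k = \tr (C k) by apply: eq_bigr => l _; rewrite Csym.
  by rewrite -/(C k); ring.
have divH k : div_form H k = c k + \sum_m G k m * W m.
  rewrite /div_form.
  under eq_bigr do under eq_bigr do rewrite covd_form_dt_metric [X in _ * X]mxE mulrDr.
  under eq_bigr do rewrite big_split.
  rewrite big_split; congr (_ + _) => /=.
    apply: eq_bigr => i' _.
    transitivity (((C i')^T *m (G *m P)) k i').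
      rewrite mulmxA [RHS]mxE; apply: eq_bigr => j _; rewrite mulrC.
      by rewrite inverse_metric_symE.
    by rewrite GP mulmx1 mxE.
  under eq_bigr do under eq_bigr do rewrite mxE.
  rewrite /W; expand_lhs; expand_rhs.
  by rewrite sum_swap23 exchange_big; do 3!apply: eq_bigr => ? _; ring.
rewrite /variation_field -/(W i) -/(c _).
rewrite -(raise_lower W i).
rewrite -sumrB; apply: eq_bigr => k _; rewrite divH trC /c /C; ring.
Qed.

End TimeDerivative.

(** The covariant divergence of a (1,1) tensor T_k^i = [T k i], over its upper index. *)
Definition div_mixed (T : 'I_n -> 'I_n -> K) k : K :=
  divergence (T k) - \sum_i \sum_m Gam i m k * T m i.

Lemma div_form_raise (B : 'M[K]_n) k :
  div_form B k = div_mixed (fun k i => \sum_j P i j * B k j) k.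
Proof.
rewrite /div_mixed divergence_raise -sumrB; apply: eq_bigr => i _.
have -> : \sum_m Gam i m k * (\sum_j P i j * B m j) = \sum_j P i j * \sum_m Gam i m k * B m j.
  expand_lhs; expand_rhs; rewrite exchange_big; do 2!apply: eq_bigr => ? _; ring.
rewrite -sumrB; apply: eq_bigr => j _; rewrite -mulrBr; congr (_ * _).
rewrite !mxE.
under eq_bigr do rewrite mxE.
under [\sum_m Gam i m j * _]eq_bigr do rewrite mulrC.
ring.
Qed.

(** Antisymmetry of the curvature in its last two indices, after raising one, turns
    this contraction into the Ricci tensor. *)
Lemma ricci_raisedE i m : \sum_j \sum_k P j k * curvature i j m k = ricci_raised i m.
Proof.
have h (F : 'M[K]_n) a b : \sum_k P b k * F a k = (F *m P) a b.
  by rewrite mxE; apply: eq_bigr => k _; rewrite mulrC inverse_metric_symE.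
under eq_bigr do rewrite h curvature_raise_antisym.
rewrite /ricci_raised.
transitivity (\sum_j \sum_k P m k * curvature j i j k).
  apply: eq_bigr => j _; by rewrite h curvature_antisym mulNmx oppmxE opprK.
rewrite exchange_big; apply: eq_bigr => k _.
by rewrite [ricci_form _ _]mxE mulr_sumr.
Qed.

(** The second Bianchi identity reads D_a F_ij = D_i F_aj - D_j F_ai, the formula for
    a variation of the curvature with C_j = F_aj.  Its trace is therefore the divergence
    of a variation field, which [ricci_raisedE] identifies with 2 Ric_a^i. *)
Lemma contracted_bianchi a : d (Some a) scalar_curvature = 2 * div_mixed ricci_raised a.
Proof.
have vf : variation_field (curvature a) =1 fun i => ricci_raised a i + ricci_raised a i.
  move=> i; rewrite /variation_field ricci_raisedE; congr (_ + _).
  rewrite /ricci_raised -sumrN; apply: eq_bigr => k _; rewrite mxE -mulrN -sumrN.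
  by congr (_ * _); apply: eq_bigr => l _; rewrite curvature_antisym oppmxE opprK.
(* Z1 to Z4 correct the four indices of g^jk F_ij^i_k other than a.  Z2 and Z4
   cancel; Z1 and Z3 are both the connection term of the divergence of Ric_a^i. *)
pose Z1 := \sum_i \sum_j \sum_k (\sum_m Gam a j m * P m k) * curvature i j i k.
pose Z2 := \sum_i \sum_j \sum_k (\sum_m P j m * Gam a k m) * curvature i j i k.
pose Z3 := \sum_i \sum_j \sum_k P j k * \sum_m Gam a i m * curvature i j m k.
pose Z4 := \sum_i \sum_j \sum_k P j k * \sum_m curvature i j i m * Gam a m k.
have -> : d (Some a) scalar_curvature = \sum_i \sum_j \sum_k P j k * covd a (curvature i j) i k
     - Z1 - Z2 - Z3 + Z4.
  rewrite scalar_curvatureE /Z1 /Z2 /Z3 /Z4 raddf_sum -!sumrB -!big_split; apply: eq_bigr => i _ /=.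
  rewrite raddf_sum -!sumrB -!big_split; apply: eq_bigr => j _ /=.
  rewrite raddf_sum -!sumrB -!big_split; apply: eq_bigr => k _ /=.
  by rewrite dM deriv_inverse_metricE [in RHS]mxE [X in _ = _ * (_ + X) - _ - _ - _ + _]mxE
    !mxE; ring.
have -> : Z2 = Z4.
  rewrite /Z2 /Z4; expand_lhs; expand_rhs.
  by rewrite sum_swap34; do 4!apply: eq_bigr => ? _; ring.
have -> : Z1 = \sum_i \sum_m Gam i m a * ricci_raised m i.
  rewrite /Z1 [LHS]exchange_big [RHS]exchange_big; apply: eq_bigr => j _ /=.
  rewrite [LHS]exchange_big /ricci_raised /=.
  under [RHS]eq_bigr do rewrite mulr_sumr.
  rewrite [RHS]exchange_big; apply: eq_bigr => k _ /=.
  rewrite -mulr_sumr mulr_suml [ricci_form _ _]mxE.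
  apply: eq_bigr => m _; rewrite (torsion_free m); ring.
have -> : Z3 = \sum_i \sum_m Gam i m a * ricci_raised m i.
  rewrite [RHS]exchange_big /Z3; apply: eq_bigr => i _.
  under [RHS]eq_bigr do rewrite -ricci_raisedE.
  expand_lhs; expand_rhs.
  (* the summation order (j,k,m) becomes (m,j,k) *)
  by rewrite sum_swap23 exchange_big; do 3!apply: eq_bigr => ? _; rewrite [Gam _ i
    a]torsion_free; ring.
have -> : \sum_i \sum_j \sum_k P j k * covd a (curvature i j) i k =
   divergence (variation_field (curvature a)).
  by rewrite -contract_variation; do 3!apply: eq_bigr => ? _; rewrite second_bianchi.
by rewrite (eq_divergence vf) divergenceD /div_mixed; ring.
Qed.

(** [c] stands for 2 r / n, which depends on time only. *)
Section ListFlow.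
Variables (alpha c u : K).
Hypothesis d_alpha : forall e, d e alpha = 0.
Hypothesis d_c : forall i, d (Some i) c = 0.

Local Notation du i := (d (Some i) u).
Definition gradient (f : K) i : K := \sum_k P i k * d (Some k) f.
Definition laplace (f : K) : K :=
  \sum_i \sum_j P i j * (d (Some i) (d (Some j) f) - \sum_k Gam i k j * d (Some k) f).
Definition energy : K := \sum_i \sum_j P i j * (du i * du j).
Definition gradient_square : 'M[K]_n := \matrix_(i, j) (du i * du j).
Definition List_form : 'M[K]_n := \matrix_(i, j) (ricci_form i j - alpha * du i * du j).
Definition List_trace : K := \sum_i \sum_j P i j * List_form i j.
Hypothesis flow_g : map_mx (d None) G = \matrix_(i, j) (- 2 * List_form i j + c * G i j).
Hypothesis flow_u : d None u = laplace u.

Lemma laplaceE f : laplace f = divergence (gradient f).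
Proof. by rewrite divergence_raise. Qed.

Lemma List_traceE : List_trace = scalar_curvature - alpha * energy.
Proof.
rewrite /List_trace /scalar_curvature /energy mulr_sumr -sumrB; apply: eq_bigr => i _.
rewrite mulr_sumr -sumrB; apply: eq_bigr => j _; rewrite [List_form _ _]mxE; ring.
Qed.

Lemma d_energy k : d (Some k) energy =
  2 * \sum_i (d (Some k) (du i) - \sum_m Gam k m i * du m) * gradient u i.
Proof.
pose X1 := \sum_i \sum_j P i j * (d (Some k) (du i) * du j).
pose X2 := \sum_i \sum_j P i j * (du i * d (Some k) (du j)).
pose Y1 := \sum_i \sum_j (\sum_m Gam k i m * P m j) * (du i * du j).
pose Y2 := \sum_i \sum_j (\sum_m P i m * Gam k j m) * (du i * du j).
have -> : d (Some k) energy = X1 + X2 - Y1 - Y2.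
  rewrite /X1 /X2 /Y1 /Y2 raddf_sum -!big_split -!sumrB; apply: eq_bigr => i _ /=.
  rewrite raddf_sum -!big_split -!sumrB; apply: eq_bigr => j _ /=.
  by rewrite !dM deriv_inverse_metricE; ring.
have -> : X2 = X1.
  rewrite /X1 exchange_big; do 2!apply: eq_bigr => ? _.
  by rewrite inverse_metric_symE; ring.
have -> : Y1 = Y2.
  rewrite /Y1 exchange_big /Y2; do 2!apply: eq_bigr => ? _.
  rewrite mulrC [RHS]mulrC; congr (_ * _); first by rewrite mulrC.
  by apply: eq_bigr => m _; rewrite inverse_metric_symE mulrC.
have -> : X1 = \sum_i d (Some k) (du i) * gradient u i.
  by rewrite /X1; expand_rhs; do 2!apply: eq_bigr => ? _; ring.
have -> : Y2 = \sum_i (\sum_m Gam k m i * du m) * gradient u i.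
  rewrite /Y2 /gradient; expand_lhs; expand_rhs.
  (* the summation order (i,j,m) becomes (m,j,i) *)
  rewrite sum_swap23 exchange_big sum_swap23 /=.
  by do 3!apply: eq_bigr => ? _; rewrite inverse_metric_symE; ring.
under [in RHS]eq_bigr do rewrite mulrBl.
rewrite sumrB; ring.
Qed.

(** div (dphi (x) dphi) = (Lap phi) dphi + (1/2) d |grad phi|^2, since the Hessian of
    phi is symmetric. *)
Lemma div_form_gradient_square k : 2 * div_form gradient_square k = 2 * (du k * laplace u) + d
  (Some k) energy.
Proof.
rewrite d_energy -mulrDr div_form_raise; congr (2 * _).
have e j i : \sum_l P i l * gradient_square j l = du j * gradient u i.
  by rewrite /gradient mulr_sumr; apply: eq_bigr => l _; rewrite mxE; ring.
rewrite /div_mixed (@eq_divergence _ (fun i => du k * gradient u i)); last by move=> i; rewrite e.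
rewrite divergenceM laplaceE -addrA; congr (_ + _); rewrite -sumrB; apply: eq_bigr => i _.
rewrite mulrBl; congr (_ - _); first by rewrite dC.
rewrite mulr_suml; apply: eq_bigr => m _.
by rewrite e torsion_free (torsion_free k) mulrA.
Qed.

Lemma div_form_ricci k : 2 * div_form ricci_form k = d (Some k) scalar_curvature.
Proof. by rewrite contracted_bianchi div_form_raise. Qed.

Lemma covd_formD i (A B : 'M[K]_n) : covd_form i (A + B) = covd_form i A + covd_form i B.
Proof. by rewrite /covd_form map_mxD mulmxDr mulmxDl; matrix_ac. Qed.

Lemma covd_formZ i a (B : 'M[K]_n) : d (Some i) a = 0 ->
  covd_form i (a *: B) = a *: covd_form i B.
Proof.
move=> da; rewrite /covd_form -scalemxAr -scalemxAl scalerBr scalerDr.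
by congr (_ - _); apply/matrixP => x y; rewrite !mxE dM da mul0r add0r.
Qed.

Lemma div_formD (A B : 'M[K]_n) k : div_form (A + B) k = div_form A k + div_form B k.
Proof.
rewrite -big_split; apply: eq_bigr => i _; rewrite -big_split; apply: eq_bigr => j _ /=.
by rewrite covd_formD [in LHS]mxE mulrDr.
Qed.

Lemma div_formZ a (B : 'M[K]_n) k : (forall i, d (Some i) a = 0) ->
  div_form (a *: B) k = a * div_form B k.
Proof.
move=> da; rewrite mulr_sumr; apply: eq_bigr => i _; rewrite mulr_sumr; apply: eq_bigr => j _ /=.
by rewrite covd_formZ // mxE mulrCA.
Qed.

Lemma div_form_metric k : div_form G k = 0.
Proof.
by rewrite /div_form; do 2!rewrite big1 // => ? _; rewrite covd_form_metric mxE mulr0.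
Qed.

Lemma derivation_natr e m : d e m%:R = 0.
Proof. by rewrite raddfMn /= (derivation1 (dM e)) mul0rn. Qed.

(** The contracted Bianchi identity and [div_form_gradient_square] combine to
    2 div S_ij = dS - 2 alpha (Lap phi) dphi. *)
Lemma div_form_flow k : div_form (map_mx (d None) G) k =
  - d (Some k) List_trace + 2 * alpha * (du k * laplace u).
Proof.
have -> : map_mx (d None) G = (- 2) *: ricci_form + (2 * alpha) *: gradient_square + c *: G.
  by rewrite flow_g; apply/matrixP => i j; rewrite !mxE; ring.
have dN2 i : d (Some i) (- 2) = 0 by rewrite raddfN /= derivation_natr oppr0.
have d2a i : d (Some i) (2 * alpha) = 0.
  by rewrite dM derivation_natr d_alpha mul0r mulr0 addr0.
rewrite !div_formD !div_formZ // div_form_metric mulNr div_form_ricci.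
rewrite mulrAC mulrC div_form_gradient_square List_traceE raddfB /= dM d_alpha; ring.
Qed.

Lemma trace_flow k : d (Some k) (\tr (P *m map_mx (d None) G)) = - 2 * d (Some k) List_trace.
Proof.
have -> : \tr (P *m map_mx (d None) G) = (- 2) * List_trace + c * n%:R.
  have -> : map_mx (d None) G = (- 2) *: List_form + c *: G.
    by rewrite flow_g; apply/matrixP => i j; rewrite !mxE.
  rewrite mulmxDr -!scalemxAr PG mxtraceD !mxtraceZ mxtrace1; congr (_ * _ + _).
  rewrite /List_trace exchange_big; apply: eq_bigr => i _; rewrite mxE; apply: eq_bigr => j _.
  by rewrite inverse_metric_symE.
by rewrite raddfD /= !dM raddfN /= !derivation_natr d_c; ring.
Qed.

(** By [div_form_flow] and [trace_flow] the variation field of the flow is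
    grad S + 2 alpha (Lap phi) grad phi.  Its divergence contributes Lap S,
    2 alpha (Lap phi)^2 and a term 2 alpha <grad phi, grad Lap phi>, which cancels with
    the one in - alpha d_t |grad phi|^2. *)
Theorem dt_List_trace : d None List_trace = laplace List_trace + 2 * alpha * laplace u ^+ 2 - c
  * List_trace
  + 2 * \tr (P *m List_form *m P *m List_form^T).
Proof.
set H := map_mx (d None) G.
have PHP : P *m H *m P = (- 2) *: (P *m List_form *m P) + c *: P.
  have -> : H = (- 2) *: List_form + c *: G.
    by rewrite /H flow_g; apply/matrixP => i j; rewrite !mxE.
  by rewrite mulmxDr mulmxDl -!scalemxAr -!scalemxAl PG mul1mx.
have -> : \tr (P *m List_form *m P *m List_form^T) = \sum_j \sum_k (P *m List_form *m P) j k *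
  List_form j k.
  apply: eq_bigr => j _; rewrite mxE; apply: eq_bigr => k _.
  by rewrite [List_form^T _ _]mxE.
have V : variation_field (fun i => map_mx (d None) (Gam i)) =1
   fun i => gradient List_trace i + (2 * alpha * laplace u) * gradient u i.
  move=> i; rewrite variation_field_dt /gradient mulr_sumr -big_split; apply: eq_bigr => k _.
  by rewrite div_form_flow trace_flow /=; ring.
have dtE : d None energy = - (\sum_j \sum_k (P *m H *m P) j k * (du j * du k))
    + 2 * \sum_i d (Some i) (laplace u) * gradient u i.
  pose X1 := \sum_i \sum_j P i j * (d None (du i) * du j).
  pose X2 := \sum_i \sum_j P i j * (du i * d None (du j)).
  have e1 : X1 = \sum_i d (Some i) (laplace u) * gradient u i.
    rewrite /X1 /gradient; expand_rhs; do 2!apply: eq_bigr => ? _; rewrite dC flow_u; ring.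
  have e2 : X2 = X1.
    rewrite /X1 exchange_big; do 2!apply: eq_bigr => ? _.
    by rewrite inverse_metric_symE; ring.
  rewrite -e1; transitivity (- (\sum_j \sum_k (P *m H *m P) j k * (du j * du k)) + X1 + X2).
    rewrite /X1 /X2 raddf_sum -sumrN -!big_split; apply: eq_bigr => i _ /=.
    rewrite raddf_sum -sumrN -!big_split; apply: eq_bigr => j _ /=.
    by rewrite !dM dt_inverse_metric; ring.
  by rewrite e2; ring.
rewrite {1}List_traceE raddfB /= dM d_alpha dt_scalar_curvature dtE (eq_divergence V)
  divergenceD -laplaceE.
rewrite divergenceM -laplaceE mul0r add0r.
have dL i : d (Some i) (2 * alpha * laplace u) = 2 * alpha * d (Some i) (laplace u).
  by rewrite !dM derivation_natr d_alpha; ring.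
have -> : \sum_i d (Some i) (2 * alpha * laplace u) * gradient u i =
   2 * alpha * \sum_i d (Some i) (laplace u) * gradient u i.
  by rewrite mulr_sumr; apply: eq_bigr => i _; rewrite dL mulrA.
have -> : \sum_j \sum_k (P *m H *m P) j k * ricci_form j k =
  alpha * (\sum_j \sum_k (P *m H *m P) j k * (du j * du k))
  - 2 * (\sum_j \sum_k (P *m List_form *m P) j k * List_form j k) + c * List_trace.
  rewrite /List_trace !mulr_sumr -sumrB -big_split; apply: eq_bigr => i _ /=.
  rewrite !mulr_sumr -sumrB -big_split; apply: eq_bigr => j _ /=.
  rewrite PHP [List_form i j]mxE; move: ricci_form (P *m List_form *m P) => Ric Q.
  by rewrite !mxE; ring.
ring.
Qed.

End ListFlow.

End Connection.

Section LeviCivita.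
Variables (K : comPzRingType) (n : nat).
Variable d : option 'I_n -> {additive K -> K}.
Variables (G P : 'M[K]_n) (h : K).
Hypothesis GP : G *m P = 1%:M.
Hypothesis Gsym : G^T = G.
Hypothesis h_half : 2 * h = 1.

Definition levi_civita i : 'M[K]_n := \matrix_(k, j)
  (h * \sum_l P k l * (d (Some i) (G j l) + d (Some j) (G i l) - d (Some l) (G i j))).

Lemma GsymE a b : G a b = G b a.
Proof. by rewrite -{1}Gsym mxE. Qed.

Lemma levi_civita_torsion_free i a b : levi_civita i a b = levi_civita b a i.
Proof.
rewrite !mxE; congr (_ * _); apply: eq_bigr => l _.
by rewrite (GsymE b i); ring.
Qed.

Lemma levi_civita_lower i a b : (G *m levi_civita i) a b =
  h * (d (Some i) (G b a) + d (Some b) (G i a) - d (Some a) (G i b)).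
Proof.
rewrite mxE.
under eq_bigr do rewrite mxE.
pose w l := d (Some i) (G b l) + d (Some b) (G i l) - d (Some l) (G i b).
transitivity (h * \sum_l (G *m P) a l * w l).
  rewrite /w [RHS]mulr_sumr; under [RHS]eq_bigr do rewrite mxE.
  expand_lhs; expand_rhs; rewrite exchange_big; do 2!apply: eq_bigr => ? _; ring.
congr (_ * _); rewrite GP (bigD1 a) //= mxE eqxx mul1r big1 ?addr0 // => l la.
by rewrite mxE eq_sym (negbTE la) mul0r.
Qed.

Lemma levi_civita_metric_compat i :
  map_mx (d (Some i)) G = (levi_civita i)^T *m G + G *m levi_civita i.
Proof.
apply/matrixP => a b; rewrite [RHS]mxE levi_civita_lower -{2}Gsym -trmx_mul.
rewrite [((_ *m _)^T) _ _]mxE levi_civita_lower mxE (GsymE b a).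
transitivity (2 * h * d (Some i) (G a b)); first by rewrite h_half mul1r.
ring.
Qed.

End LeviCivita.

(** * Positive definite matrices *)

Section PositiveDefinite.
Variable R : rcfType.

Definition posdef n (G : 'M[R]_n) :=
  G^T = G /\ forall v : 'rV[R]_n, v != 0 -> 0 < (v *m G *m v^T) 0 0.

(** Existence of an orthonormal basis, the rows of [E], by induction on the size:
    one step of Gaussian elimination splits off the first coordinate, and the Schur
    complement is again positive definite. *)
Lemma posdef_orthonormal n (G : 'M[R]_n) : posdef G ->
  exists E : 'M[R]_n, E *m G *m E^T = 1%:M.
Proof.
elim: n G => [|n IH] G [Gsym Gpos].
  by exists 0; rewrite [LHS]flatmx0 [RHS]flatmx0.
move: G Gsym Gpos; rewrite -[n.+1]/(1 + n)%N => G Gsym Gpos.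
pose a := G 0 0.
have a_gt0 : 0 < a.
  have e0 : delta_mx 0 0 != 0 :> 'rV[R]_(1 + n).
    by apply/eqP => /rowP/(_ 0) /eqP; rewrite !mxE eqxx oner_eq0.
  have := Gpos _ e0; rewrite -rowE trmx_delta -colE.
  by rewrite !mxE.
pose b : 'rV[R]_n := ursubmx G.
have GE : G = block_mx a%:M b b^T (drsubmx G).
  rewrite -[LHS]submxK; congr block_mx.
    by rewrite [ulsubmx G]mx11_scalar; congr (_%:M); rewrite !mxE; congr (G _ _); apply/val_inj.
  by rewrite /b trmx_ursub Gsym.
set D := drsubmx G in GE.
have Dsym : D^T = D by rewrite /D trmx_drsub Gsym.
pose D' := D - a^-1 *: (b^T *m b).
(* [L] clears the first row and column; the remaining block is [D']. *)
pose L : 'M[R]_(1 + n) := block_mx 1%:M 0 (- a^-1 *: b^T) 1%:M.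
have a0 : a != 0 by rewrite gt_eqF.
have LGL : L *m G *m L^T = block_mx a%:M 0 0 D'.
  rewrite GE /L tr_block_mx !mulmx_block !trmx1 !trmx0 !mul1mx !mulmx1 !mul0mx !mulmx0 !addr0.
  rewrite !linearZ /= trmxK -!scalemxAl mul_scalar_mx mul_mx_scalar !scalerA.
  rewrite !mulNr !mulVf // !scaleN1r !addNr mul0mx scaler0 add0r.
  by rewrite /D' scaleNr addrC.
have D'pos : posdef D'.
  split.
    by rewrite /D' !linearB /= linearZ /= trmx_mul trmxK Dsym.
  move=> v v0; pose w : 'rV_(1 + n) := row_mx 0 v *m L.
  have w0 : w != 0.
    rewrite /w /L mul_row_block !mul0mx !add0r mulmx1.
    apply: contra v0 => /eqP /(congr1 rsubmx); rewrite row_mxKr => ->.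
    by rewrite linear0.
  have := Gpos _ w0; rewrite /w trmx_mul !mulmxA.
  rewrite -(mulmxA _ L) -(mulmxA _ (L *m G)) LGL mul_row_block.
  rewrite !mul0mx !mulmx0 !add0r tr_row_mx mul_row_col mul0mx add0r.
  by [].
have [E' E'1] := IH _ D'pos.
pose s := (Num.sqrt a)^-1.
exists (block_mx s%:M 0 0 E' *m L).
rewrite trmx_mul !mulmxA -(mulmxA _ L) -(mulmxA _ (L *m G)) LGL.
rewrite tr_block_mx !mulmx_block !trmx0 !mul0mx !mulmx0 !addr0 !add0r ?mul0mx E'1.
rewrite tr_scalar_mx -!scalar_mxM.
have -> : s * a * s = 1.
  rewrite /s -{2}[a]sqr_sqrtr ?ltW // expr2 mulrA mulVf ?mul1r ?mulfV //;
   by rewrite gt_eqF // sqrtr_gt0.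
by rewrite -scalar_mx_block.
Qed.

Section Traces.
Variables (n : nat) (G P : 'M[R]_n).
Hypotheses (Gpd : posdef G) (PG : P *m G = 1%:M).

Lemma posdef_inv_factor : exists E : 'M[R]_n, P = E^T *m E.
Proof.
have [E EGE] := posdef_orthonormal Gpd.
exists E.
have h : G *m (E^T *m E) = 1%:M.
  by rewrite mulmxA; apply: mulmx1C; rewrite mulmxA.
by rewrite -[LHS]mulmx1 -h mulmxA PG mul1mx.
Qed.

(** With P = E^T E the trace is the sum of the values of the quadratic form [H] on the
    rows of [E]. *)
Lemma mxtrace_posdef_inv_ge0 (H : 'M[R]_n) :
  (forall v : 'rV[R]_n, 0 <= (v *m H *m v^T) 0 0) -> 0 <= \tr (P *m H).
Proof.
move=> Hpos; have [E ->] := posdef_inv_factor.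
rewrite -mulmxA mxtrace_mulC; apply: sumr_ge0 => i _.
have := Hpos (row i E); rewrite -row_mul tr_row.
rewrite -!mulmxA -!row_mul !mulmxA !mxE; under eq_bigr do rewrite !mxE.
by under [X in _ -> _ <= X]eq_bigr do rewrite !mxE.
Qed.

(** With P = E^T E the trace is the sum of the squares of the entries of E S E^T, so it
    is the norm |S_ij|^2. *)
Lemma mxtrace_posdef_inv_sq_ge0 (S : 'M[R]_n) : 0 <= \tr (P *m S *m P *m S^T).
Proof.
have [E ->] := posdef_inv_factor.
rewrite -!mulmxA mxtrace_mulC !mulmxA.
set X := E *m S *m E^T.
have -> : X *m E *m S^T *m E^T = X *m X^T by rewrite /X !trmx_mul trmxK !mulmxA.
apply: sumr_ge0 => i _; rewrite mxE; apply: sumr_ge0 => j _.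
by rewrite [X^T _ _]mxE -expr2 sqr_ge0.
Qed.

End Traces.

Lemma posdef_unit n (G : 'M[R]_n) : posdef G -> G \in unitmx.
Proof.
move=> /posdef_orthonormal[E]; rewrite -mulmxA => h.
by have := mulmx1C h; rewrite -mulmxA => /mulmx1_unit[].
Qed.

End PositiveDefinite.

(** * One-sided derivatives on an interval *)

Section OneVariable.
Variable R : realType.
Implicit Types (J A B : set R) (f g : R -> R) (t l : R).

(** First-order expansion along [J].  For a point isolated in [J] it holds for every
    [l], so uniqueness requires [accumulation]. *)
Definition has_tderiv J f t l : Prop := forall e, 0 < e -> exists2 dl, 0 < dl &
  forall s, J s -> `|s - t| < dl -> `|f s - f t - l * (s - t)| <= e * `|s - t|.

Lemma near_dnbhsP J t (P : R -> Prop) :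
  (\forall s \near within J t^', P s) <->
  exists2 dl : R, 0 < dl & forall s, J s -> s != t -> `|s - t| < dl -> P s.
Proof.
split.
  rewrite /within /dnbhs /within /= !nearE => /nbhs_ballP[d /= d0 h].
  exists d => // s Js st sd; apply: h => //.
  by rewrite /ball /= distrC.
move=> [d d0 h]; rewrite /within /dnbhs /within /= nearE; apply/nbhs_ballP.
by exists d => //= s sd st Js; apply: h => //; rewrite distrC.
Qed.

Lemma has_tderivP J f t l : has_tderiv J f t l <->
  (f s - f t) / (s - t) @[s --> within J t^'] --> l.
Proof.
split=> [h|h].
  apply/cvgrPdist_le => e e0; apply/near_dnbhsP.
  have [d d0 hd] := h e e0; exists d => // s Js st sd.
  have st0 : s - t != 0 by rewrite subr_eq0.
  rewrite -(ler_pM2r (_ : 0 < `|s - t|)) ?normr_gt0 // -normrM mulrBl divfK // distrC.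
  exact: hd.
move=> e e0; have /cvgrPdist_le/(_ e e0)/near_dnbhsP[d d0 hd] := h.
exists d => // s Js sd; have [->|st] := eqVneq s t; first by rewrite !subrr mulr0 subr0 normr0
  mulr0.
have st0 : s - t != 0 by rewrite subr_eq0.
have := hd s Js st sd.
by rewrite -(ler_pM2r (_ : 0 < `|s - t|)) ?normr_gt0 // -normrM mulrBl divfK // distrC.
Qed.

Definition accumulation J t := forall d, 0 < d -> exists2 s, J s & s != t /\ `|s - t| < d.

Lemma accumulation_proper J t : accumulation J t -> ProperFilter (within J t^').
Proof.
move=> acc; apply: Build_ProperFilter_ex => P /near_dnbhsP[d d0 h].
by have [s Js [st sd]] := acc d d0; exists s; apply: h.
Qed.

Lemma has_tderiv_tderiv J f t l : accumulation J t -> has_tderiv J f t l ->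
  tderivable J f t /\ tderiv J f t = l.
Proof.
move=> /accumulation_proper pf /has_tderivP h; split; first by apply/cvg_ex; exists l.
by apply: cvg_lim => //; exact: norm_hausdorff.
Qed.

Lemma tderivable_has J f t : tderivable J f t -> has_tderiv J f t (tderiv J f t).
Proof. by move=> h; apply/has_tderivP. Qed.

Lemma has_tderiv_sub A B f t l : A `<=` B -> has_tderiv B f t l -> has_tderiv A f t l.
Proof.
by move=> AB h e /h[d d0 hd]; exists d => // s /AB; apply: hd.
Qed.

Lemma has_tderiv_eq J f g t l : J t -> (forall s, J s -> f s = g s) ->
  has_tderiv J f t l -> has_tderiv J g t l.
Proof.
by move=> Jt e h ep /h[d d0 hd]; exists d => // s Js; rewrite -!e //; apply: hd.
Qed.

Lemma has_tderiv_local J f g t l d : 0 < d -> f t = g t ->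
  (forall s, J s -> `|s - t| < d -> f s = g s) ->
  has_tderiv J f t l -> has_tderiv J g t l.
Proof.
move=> d0 ft e h ep /h[d' d'0 hd]; exists (Num.min d d'); first by rewrite lt_min d0.
by move=> s Js; rewrite lt_min => /andP[sd sd']; rewrite -e // -ft; apply: hd.
Qed.

Lemma has_tderiv_cst J c t : has_tderiv J (fun=> c) t 0.
Proof.
by move=> e e0; exists 1 => // s _ _; rewrite subrr mul0r subrr normr0 mulr_ge0 // ltW.
Qed.

Lemma has_tderivD J f g t l m : has_tderiv J f t l -> has_tderiv J g t m ->
  has_tderiv J (fun s => f s + g s) t (l + m).
Proof.
move=> /has_tderivP hf /has_tderivP hg; apply/has_tderivP.
have -> : (fun s => (f s + g s - (f t + g t)) / (s - t)) =
   (fun s => (f s - f t) / (s - t) + (g s - g t) / (s - t)).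
  by apply/funext => s; rewrite -mulrDl; congr (_ / _); ring.
exact: cvgD.
Qed.

Lemma has_tderiv_continuous J f t l : has_tderiv J f t l ->
  f s @[s --> within J (nbhs t)] --> f t.
Proof.
move=> h; have [d d0 hd] := h 1 ltr01.
apply/cvgrPdist_lt => e e0; rewrite near_withinE; apply/nbhs_ballP.
have l1 : 0 < `|l| + 1 by rewrite ltr_wpDl.
exists (Num.min d (e / (`|l| + 1))) => /=; first by rewrite lt_min d0 divr_gt0.
move=> s; rewrite /ball /= lt_min => /andP[sd se] Js; rewrite distrC in sd se.
rewrite distrC (le_lt_trans (_ : _ <= (`|l| + 1) * `|s - t|)) //; last first.
  by rewrite mulrC -ltr_pdivlMr.
rewrite -[f s - f t](subrK (l * (s - t))) mulrDl addrC.
by rewrite (le_trans (ler_normD _ _)) // lerD // ?normrM // hd.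
Qed.

Lemma dnbhs_within_sub J t : within J t^' --> within J (nbhs t).
Proof.
move=> P h; apply/(near_dnbhsP _ _ P).
have : \forall s \near within J (nbhs t), P s by exact: h.
rewrite near_withinE => /nbhs_ballP[d d0 hd]; exists d => // s Js _ sd.
by apply: hd => //; rewrite /ball /= distrC.
Qed.

Lemma has_tderivM J f g t l m : has_tderiv J f t l -> has_tderiv J g t m ->
  has_tderiv J (fun s => f s * g s) t (l * g t + f t * m).
Proof.
move=> /has_tderivP hf hg; have cg := has_tderiv_continuous hg.
move: hg => /has_tderivP hg; apply/has_tderivP.
have -> : (fun s => (f s * g s - f t * g t) / (s - t)) =
   (fun s => (f s - f t) / (s - t) * g s + f t * ((g s - g t) / (s - t))).
  by apply/funext => s; rewrite mulrAC mulrA -mulrDl; congr (_ / _); ring.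
apply: cvgD; apply: cvgM => //; last exact: cvg_cst.
by apply: cvg_trans cg; apply: cvg_app; exact: dnbhs_within_sub.
Qed.

Lemma has_tderivV J f t l : J t -> f t != 0 -> has_tderiv J f t l ->
  has_tderiv J (fun s => (f s)^-1) t (- (l * (f t)^-1 * (f t)^-1)).
Proof.
move=> Jt ft hf; have cf := has_tderiv_continuous hf.
have {}cf : f s @[s --> within J t^'] --> f t.
  by apply: cvg_trans cf; apply: cvg_app; exact: dnbhs_within_sub.
move: hf => /has_tderivP hf; apply/has_tderivP.
suff : (- ((f s - f t) / (s - t) * (f s)^-1 * (f t)^-1)) @[s --> within J t^'] -->
   (- (l * (f t)^-1 * (f t)^-1)).
  apply: cvg_trans; apply: near_eq_cvg; apply/near_dnbhsP.
  have ft2 : 0 < `|f t| by rewrite normr_gt0.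
  have /cvgrPdist_lt/(_ _ ft2)/near_dnbhsP[d d0 hd] := cf.
  exists d => // s Js st sd /=; have st0 : s - t != 0 by rewrite subr_eq0.
  have fs : f s != 0.
    by apply/eqP => e; have := hd s Js st sd; rewrite e subr0 ltxx.
  by field; rewrite fs ft st0.
by apply: cvgN; apply: cvgM; [apply: cvgM => //; apply: cvgV | exact: cvg_cst].
Qed.

Lemma has_tderiv_shift J f c t l : has_tderiv J f (t + c) l ->
  has_tderiv [set s | J (s + c)] (fun s => f (s + c)) t l.
Proof.
move=> h e /h[d d0 hd]; exists d => // s /= Js sd.
have E : s + c - (t + c) = s - t by ring.
by have := hd (s + c) Js; rewrite E; exact.
Qed.

Lemma derive_has_tderiv (V : normedModType R) (f : V -> R) x v :
  derivable f x v <-> exists l, has_tderiv setT (fun h => f (h *: v + x)) 0 l.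
Proof.
have e : (fun h => h^-1 *: ((f \o shift x) (h *: v) - f x)) =
  (fun h => (f (h *: v + x) - f (0 *: v + x)) / (h - 0)).
  by apply/funext => h /=; rewrite scale0r add0r subr0 mulrC.
split=> [/cvg_ex[l]|[l /has_tderivP h]].
  by rewrite e => h; exists l; apply/has_tderivP; rewrite withinET.
by apply/cvg_ex; exists l; rewrite e; move: h; rewrite withinET.
Qed.

Lemma has_tderiv_derive (V : normedModType R) (f : V -> R) x v l :
  has_tderiv setT (fun h => f (h *: v + x)) 0 l -> derivable f x v /\ 'D_v f x = l.
Proof.
have e : (fun h => h^-1 *: ((f \o shift x) (h *: v) - f x)) =
  (fun h => (f (h *: v + x) - f (0 *: v + x)) / (h - 0)).
  by apply/funext => h /=; rewrite scale0r add0r subr0 mulrC.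
move=> /has_tderivP; rewrite withinET -e => h; split; first by apply/cvg_ex; exists l.
by apply: cvg_lim => //; exact: norm_hausdorff.
Qed.

Lemma derivable_has_tderiv (V : normedModType R) (f : V -> R) x v :
  derivable f x v -> has_tderiv setT (fun h => f (h *: v + x)) 0 ('D_v f x).
Proof.
by move=> /derive_has_tderiv[l h]; have [_ ->] := has_tderiv_derive h.
Qed.

Lemma has_tderiv_is_derive f t l : has_tderiv setT f t l -> is_derive t 1 f l.
Proof.
rewrite -{1}[t]add0r => /has_tderiv_shift h.
have [dv <-] : derivable f t 1 /\ 'D_1 f t = l.
  apply: has_tderiv_derive; apply: has_tderiv_eq h => // s _.
  by rewrite [s *: 1]mulr1.
by split.
Qed.

(** A derivative relative to the interval [A] is a true derivative at interior points of
    [A], and implies continuity at its ends. *)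
Lemma MVT_within_lt A f f' x y : is_interval A -> A x -> A y -> x < y ->
  (forall s, A s -> has_tderiv A f s (f' s)) ->
  exists c, [/\ A c, x < c < y & f y - f x = f' c * (y - x)].
Proof.
move=> Ai Ax Ay xy hf.
have Ac c : c \in `[x, y] -> A c.
  by rewrite in_itv /=; exact: Ai.
have [c cxy e] : exists2 c, c \in `]x, y[ & f y - f x = f' c * (y - x).
  apply: MVT => //.
    move=> c; rewrite in_itv /= => /andP[xc cy]; apply: has_tderiv_is_derive.
    have Ac' : A c by apply: Ac; rewrite in_itv /= !ltW.
    move=> e e0; have [d d0 hd] := hf c Ac' e e0.
    exists (Num.min d (Num.min (c - x) (y - c))); first by rewrite !lt_min d0 !subr_gt0 xc.
    move=> s _; rewrite !lt_min => /andP[sd /andP[]]; rewrite !ltr_norml => s1 s2.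
    by apply: hd => //; apply: Ac; rewrite in_itv /=; lra.
  apply/subspace_continuousP => z; rewrite /= => /Ac/hf /has_tderiv_continuous.
  apply: cvg_trans; apply: cvg_app; apply: within_subset.
  by move=> s /Ac.
exists c; move: cxy; rewrite in_itv /= => cxy.
by split=> //; apply: Ac; rewrite in_itv /=; lra.
Qed.

Lemma MVT_within A f f' x y : is_interval A -> A x -> A y ->
  (forall s, A s -> has_tderiv A f s (f' s)) ->
  exists c, [/\ A c, `|c - x| <= `|y - x| & f y - f x = f' c * (y - x)].
Proof.
move=> Ai Ax Ay hf; have [xy|yx|->] := ltgtP x y.
- have [c [Ac cxy e]] := MVT_within_lt Ai Ax Ay xy hf.
  by exists c; split=> //; rewrite !gtr0_norm; lra.
- have [c [Ac cxy e]] := MVT_within_lt Ai Ay Ax yx hf.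
  exists c; split=> //; first by rewrite !ltr0_norm; lra.
  by rewrite -[LHS]opprB e; ring.
- by exists y; rewrite !subrr mulr0.
Qed.

(** The classical argument: two applications of the mean value theorem in either order
    evaluate the same second difference at nearby points.  The derivatives are relative
    to intervals, so that an end of the time interval is allowed as [a0]. *)
Lemma schwarz A B (phi phia phib phiab phiba : R -> R -> R) a0 b0 :
  is_interval A -> is_interval B -> accumulation A a0 -> accumulation B b0 -> A a0 -> B b0 ->
  (forall a b, A a -> B b -> has_tderiv A (phi^~ b) a (phia a b)) ->
  (forall a b, A a -> B b -> has_tderiv B (phi a) b (phib a b)) ->
  (forall a b, A a -> B b -> has_tderiv B (phia a) b (phiab a b)) ->
  (forall a b, A a -> B b -> has_tderiv A (phib^~ b) a (phiba a b)) ->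
  (forall e, 0 < e -> exists2 d, 0 < d & forall a b, A a -> B b ->
     `|a - a0| < d -> `|b - b0| < d -> `|phiab a b - phiab a0 b0| < e) ->
  (forall e, 0 < e -> exists2 d, 0 < d & forall a b, A a -> B b ->
     `|a - a0| < d -> `|b - b0| < d -> `|phiba a b - phiba a0 b0| < e) ->
  phiab a0 b0 = phiba a0 b0.
Proof.
move=> Ai Bi accA accB Aa0 Bb0 ha hb hab hba cab cba.
apply/eqP; rewrite -subr_eq0 -normr_le0; apply/ler_addgt0Pl => e e0; rewrite addr0.
have e2 : 0 < e / 2 by rewrite divr_gt0.
have [d1 d10 h1] := cab _ e2; have [d2 d20 h2] := cba _ e2.
pose d := Num.min d1 d2; have d0 : 0 < d by rewrite lt_min d10.
have [a1 Aa1 [a10 a1d]] := accA _ d0; have [b1 Bb1 [b10 b1d]] := accB _ d0.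
have dD f g J t l m : has_tderiv J f t l -> has_tderiv J g t m ->
  has_tderiv J (fun s => f s - g s) t (l - m).
  move=> hf hg; have -> : l - m = l + (0 * g t + (-1) * m) by ring.
  have := has_tderivD hf (has_tderivM (has_tderiv_cst J (-1) t) hg).
  by congr has_tderiv; apply/funext => s; rewrite mulN1r.
have [c1 [Ac1 c1d e1]] := MVT_within Ai Aa0 Aa1
  (fun s As => dD _ _ _ _ _ _ (ha s b1 As Bb1) (ha s b0 As Bb0)).
have [c2 [Bc2 c2d e2']] := MVT_within Bi Bb0 Bb1 (fun s Bs => hab c1 s Ac1 Bs).
have [c3 [Bc3 c3d e3]] := MVT_within Bi Bb0 Bb1
  (fun s Bs => dD _ _ _ _ _ _ (hb a1 s Aa1 Bs) (hb a0 s Aa0 Bs)).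
have [c4 [Ac4 c4d e4]] := MVT_within Ai Aa0 Aa1 (fun s As => hba s c3 As Bc3).
have E : phiab c1 c2 = phiba c4 c3.
  have : phiab c1 c2 * ((a1 - a0) * (b1 - b0)) = phiba c4 c3 * ((a1 - a0) * (b1 - b0)).
    rewrite e2' in e1; rewrite e4 in e3.
    have -> : phiab c1 c2 * ((a1 - a0) * (b1 - b0)) = phiab c1 c2 * (b1 - b0) * (a1 - a0) by ring.
    by rewrite -e1 mulrA -e3; ring.
  by apply/mulIf; rewrite mulf_neq0 // subr_eq0.
have := h1 c1 c2 Ac1 Bc2; have := h2 c4 c3 Ac4 Bc3.
move: a1d b1d; rewrite !lt_min => /andP[a1d1 a1d2] /andP[b1d1 b1d2].
move=> /(_ (le_lt_trans c4d a1d2) (le_lt_trans c3d b1d2)) k2.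
move=> /(_ (le_lt_trans c1d a1d1) (le_lt_trans c2d b1d1)) k1.
rewrite -E in k2; move: k1 k2; rewrite !ltr_norml ler_norml; lra.
Qed.

Lemma has_tderiv_sum (I : Type) (r : seq I) J (F : I -> R -> R) t (L : I -> R) :
  (forall i, has_tderiv J (F i) t (L i)) ->
  has_tderiv J (fun s => \sum_(i <- r) F i s) t (\sum_(i <- r) L i).
Proof.
move=> hF; elim: r => [|i r IH].
  rewrite big_nil; under eq_fun do rewrite big_nil.
  exact: has_tderiv_cst.
rewrite big_cons; under eq_fun do rewrite big_cons.
exact: has_tderivD.
Qed.

Lemma has_tderiv_left_min J f t l : has_tderiv J f t l ->
  (forall d, 0 < d -> exists2 s, J s & t - d < s < t /\ f t <= f s) -> l <= 0.
Proof.
move=> hf hm; rewrite leNgt; apply/negP => l0.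
have l2 : 0 < l / 2 by rewrite divr_gt0.
have [d d0 hd] := hf _ l2; have [s Js [sd fs]] := hm _ d0.
have st : `|s - t| = t - s by rewrite ltr0_norm; lra.
have := hd s Js; rewrite st ler_norml => /(_ _)/andP[]; first by lra.
move=> _ h; have : l / 2 * (t - s) > 0 by rewrite mulr_gt0 //; lra.
lra.
Qed.

Lemma has_tderiv_right_min J f t l : has_tderiv J f t l ->
  (forall d, 0 < d -> exists2 s, J s & t < s < t + d /\ f t <= f s) -> 0 <= l.
Proof.
move=> hf hm; rewrite leNgt; apply/negP => l0.
have l2 : 0 < - (l / 2) by rewrite oppr_gt0; lra.
have [d d0 hd] := hf _ l2; have [s Js [sd fs]] := hm _ d0.
have st : `|s - t| = s - t by rewrite gtr0_norm; lra.
have := hd s Js; rewrite st ler_norml => /(_ _)/andP[]; first by lra.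
move=> _ h; have : - (l / 2) * (s - t) > 0 by rewrite mulr_gt0 //; lra.
lra.
Qed.

Lemma second_derivative_min g h l d : 0 < d ->
  (forall s, `|s| < d -> has_tderiv setT g s (h s)) -> has_tderiv setT h 0 l ->
  (forall s, `|s| < d -> g 0 <= g s) -> h 0 = 0 /\ 0 <= l.
Proof.
move=> d0 hg hh gmin.
have g0 : has_tderiv setT g 0 (h 0) by apply: hg; rewrite normr0.
have h0 : h 0 = 0.
  apply/eqP; rewrite eq_le; apply/andP; split.
    apply: (has_tderiv_left_min g0) => e e0; have m0 : 0 < Num.min d e by rewrite lt_min d0.
    exists (- (Num.min d e / 2)) => //; have [m1 m2] : Num.min d e <= d /\ Num.min d e <= e.
      by rewrite !ge_min !lexx orbT.
    split; first lra.
    by apply: gmin; rewrite normrN gtr0_norm; lra.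
  apply: (has_tderiv_right_min g0) => e e0; have m0 : 0 < Num.min d e by rewrite lt_min d0.
  exists (Num.min d e / 2) => //; have [m1 m2] : Num.min d e <= d /\ Num.min d e <= e.
    by rewrite !ge_min !lexx orbT.
  split; first lra.
  by apply: gmin; rewrite gtr0_norm; lra.
split=> //; rewrite leNgt; apply/negP => l0.
have l2 : 0 < - (l / 2) by rewrite oppr_gt0; lra.
have [e e0 he] := hh _ l2.
have m0 : 0 < Num.min d e by rewrite lt_min d0.
have [m1 m2] : Num.min d e <= d /\ Num.min d e <= e by rewrite !ge_min !lexx orbT.
pose s := Num.min d e / 2; have s0 : 0 < s by rewrite divr_gt0.
pose A := [set a : R | `|a| < d].
have Ai : is_interval A.
  by move=> a b /= Aa Ab z zab; move: Aa Ab; rewrite /A /= !ltr_norml; lra.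
have [] := @MVT_within_lt A g h 0 s Ai _ _ s0.
- by rewrite /A /= normr0.
- by rewrite /A /= gtr0_norm // /s; lra.
- by move=> a Aa; apply: (has_tderiv_sub (@subsetT _ _)); apply: hg.
move=> c [Ac c0s e1]; have := gmin s; rewrite gtr0_norm // => /(_ _).
have -> : g s = g 0 + h c * s by rewrite -[s in RHS]subr0 -e1; ring.
have : h c < 0.
  have ce : c < e by rewrite /s in c0s; lra.
  have c0 : 0 < c by lra.
  have := he c I; rewrite h0 !subr0 gtr0_norm // => /(_ ce); rewrite ler_norml => /andP[_].
  have : l * c < 0 by rewrite nmulr_rlt0.
  lra.
move=> hc H; have : h c * s < 0 by rewrite nmulr_rlt0.
by have := H _; rewrite /s; lra.
Qed.

End OneVariable.

Lemma is_derive_has_tderiv (R : realType) (f : R -> R) (t l : R) :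
  is_derive t 1 f l -> has_tderiv setT f t l.
Proof.
move=> [dv <-]; have := derivable_has_tderiv dv; rewrite -{1}(subrr t) => /has_tderiv_shift h.
by apply: has_tderiv_eq h => // s _; rewrite [_ *: 1]mulr1 subrK.
Qed.

Lemma has_tderiv_expR (R : realType) (J : set R) (L t : R) :
  has_tderiv J (fun s => expR (- L * s)) t (- L * expR (- L * t)).
Proof.
apply: (has_tderiv_sub (@subsetT _ _)); apply: is_derive_has_tderiv.
have hL : is_derive t (1 : R) (fun s : R => - L * s) (- L).
  have h := is_deriveZ (- L) (is_derive_id t (1 : R)).
  by apply: (is_derive_eq h); rewrite /= [_ *: _]mulr1.
by have := is_derive1_comp (is_derive_expR (- L * t)) hL; rewrite mulrC.
Qed.

(** * Functions on an open set of coordinate space *)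

Section SeveralVariables.
Variables (R : realType) (n : nat) (D : set 'rV[R]_n).
Hypothesis D_open : open D.

Lemma open_ballP x : D x -> exists2 d : R, 0 < d & forall y, `|y - x| < d -> D y.
Proof.
move=> Dx; have /nbhs_ballP[d d0 hd] : nbhs x D by apply: open_nbhs_nbhs.
exists d => // y yx; apply: hd.
by rewrite -ball_normE /ball_ /= distrC.
Qed.

Lemma continuous_ballP (f : 'rV[R]_n -> R) x : {for x, continuous f} ->
  forall e, 0 < e -> exists2 d : R, 0 < d & forall y, `|y - x| < d -> `|f y - f x| < e.
Proof.
move=> /cvgrPdist_lt cf e /cf /nbhs_ballP[d d0 hd]; exists d => // y yx.
by rewrite distrC; apply: hd; rewrite -ball_normE /ball_ /= distrC.
Qed.

Lemma pderiv_has_tderiv (f : 'rV[R]_n -> R) k y a : derivable f (a *: 'e_k + y) 'e_k ->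
  has_tderiv setT (fun s => f (s *: 'e_k + y)) a (pderiv k f (a *: 'e_k + y)).
Proof.
move=> /derivable_has_tderiv h; rewrite -/(pderiv k f _) in h.
rewrite -(subrr a) in h; move: h => /has_tderiv_shift h.
apply: has_tderiv_eq h => // s _; rewrite addrA -scalerDl; congr (f (_ *: _ + _)); ring.
Qed.

Section DirectionalDerivative.
Variable f : 'rV[R]_n -> R.
Hypothesis f_deriv : forall (y : 'rV[R]_n) (k : 'I_n), D y -> derivable f y 'e_k.
Hypothesis f_cont : forall (y : 'rV[R]_n) (k : 'I_n), D y -> {for y, continuous (pderiv k f)}.

(** By the mean value theorem the increment is s c times a partial derivative at a
    point that tends to [x] with s. *)
Lemma increment_along_axis x (w : 'rV[R]_n) c (k : 'I_n) : D x ->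
  has_tderiv setT (fun s => f ((s * c) *: 'e_k + (s *: w + x)) - f (s *: w + x)) 0
    (c * pderiv k f x).
Proof.
move=> Dx e e0; have c1 : 0 < `|c| + 1 by rewrite ltr_wpDl.
have [d1 d10 h1] := open_ballP Dx.
have [d2 d20 h2] := continuous_ballP (@f_cont x k Dx) (divr_gt0 e0 c1).
pose E := `|c| * `|'e_k : 'rV[R]_n| + `|w| + 1.
have E0 : 0 < E by rewrite ltr_wpDl // addr_ge0 // mulr_ge0.
exists (Num.min d1 d2 / E); first by rewrite divr_gt0 // lt_min d10.
move=> s _; rewrite subr0 mul0r !scale0r !add0r subrr subr0 ltr_pdivlMr // => sE.
pose A := [set a : R | `|a| <= `|s * c|].
have near a : A a -> `|a *: 'e_k + (s *: w + x) - x| < Num.min d1 d2.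
  rewrite /A /= => Aa; apply: le_lt_trans sE; rewrite addrA addrK.
  rewrite (le_trans (ler_normD _ _)) // !normrZ /E !mulrDr mulr1 mulrA -normrM.
  by rewrite ler_wpDr // lerD // ler_wpM2r.
have Ai : is_interval A.
  by move=> a b /= Aa Ab z zab; move: Aa Ab; rewrite /A /= !ler_norml; lra.
have A0 : A 0 by rewrite /A /= normr0.
have A1 : A (s * c) by rewrite /A /=.
have [] := @MVT_within _ A (fun a => f (a *: 'e_k + (s *: w + x)))
   (fun a => pderiv k f (a *: 'e_k + (s *: w + x))) 0 (s * c) Ai A0 A1.
  move=> a /near; rewrite lt_min => /andP[/h1 Da _].
  by apply: (has_tderiv_sub (@subsetT _ _)); apply: pderiv_has_tderiv; exact: f_deriv.
move=> b [Ab _]; rewrite scale0r add0r subr0 => ->.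
have /near := Ab; rewrite lt_min => /andP[_ /h2].
set p := pderiv k f _; set q := pderiv k f _ => pq.
have -> : p * (s * c) - c * q * s = (p - q) * c * s by ring.
rewrite !normrM ler_wpM2r //.
apply: le_trans (ler_wpM2r _ (ltW pq)) _ => //.
by rewrite mulrAC ler_pdivrMr // ler_pM2l // lerDl.
Qed.

(** A function with continuous partial derivatives is differentiated along [v] by
    moving along one coordinate axis at a time. *)
Lemma directional_derivative x (v : 'rV[R]_n) : D x ->
  has_tderiv setT (fun s => f (s *: v + x)) 0 (\sum_k v 0 k * pderiv k f x).
Proof.
move=> Dx; rewrite {1}(row_sum_delta v).
elim: (index_enum _) => [|k r IH].
  rewrite !big_nil; apply: has_tderiv_eq (has_tderiv_cst _ (f x) 0) => // s _.
  by rewrite scaler0 add0r.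
rewrite !big_cons.
have := has_tderivD (increment_along_axis (\sum_(j <- r) v 0 j *: 'e_j) (v 0 k) k Dx) IH.
apply: has_tderiv_eq => // s _; rewrite subrK scalerDr scalerA; congr (f _).
by rewrite addrA.
Qed.

Lemma directional_derivative_line x (v : 'rV[R]_n) a : D (a *: v + x) ->
  has_tderiv setT (fun s => f (s *: v + x)) a (\sum_k v 0 k * pderiv k f (a *: v + x)).
Proof.
move=> /directional_derivative h; have := h v; rewrite -(subrr a) => /has_tderiv_shift {}h.
apply: has_tderiv_eq h => // s _; rewrite addrA -scalerDl; congr (f (_ *: _ + _)); ring.
Qed.

End DirectionalDerivative.

(** Each line through the minimum reduces the claim to one variable. *)
Lemma local_min_Hessian (f : 'rV[R]_n -> R) x : D x ->
  (forall (y : 'rV[R]_n) (k : 'I_n), D y -> derivable f y 'e_k) ->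
  (forall (y : 'rV[R]_n) (k : 'I_n), D y -> {for y, continuous (pderiv k f)}) ->
  (forall (y : 'rV[R]_n) (k l : 'I_n), D y -> derivable (pderiv l f) y 'e_k) ->
  (forall (y : 'rV[R]_n) (k l : 'I_n), D y -> {for y, continuous (pderiv k (pderiv l f))}) ->
  (forall y, D y -> f x <= f y) ->
  (forall k, pderiv k f x = 0) /\
  forall v : 'rV[R]_n, 0 <= (v *m (\matrix_(k, l) pderiv k (pderiv l f) x) *m v^T) 0 0.
Proof.
move=> Dx f1 f2 f3 f4 fmin.
have [d d0 hd] := open_ballP Dx.
have main (v : 'rV[R]_n) : \sum_k v 0 k * pderiv k f x = 0 /\
    0 <= \sum_l v 0 l * \sum_k v 0 k * pderiv k (pderiv l f) x.
  have v1 : 0 < `|v| + 1 by rewrite ltr_wpDl.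
  have near s : `|s| < d / (`|v| + 1) -> D (s *: v + x).
    move=> sd; apply: hd; rewrite addrK normrZ.
    rewrite ltr_pdivlMr // in sd; apply: le_lt_trans sd.
    by rewrite ler_wpM2l // lerDl.
  have := @second_derivative_min _ (fun s => f (s *: v + x))
    (fun s => \sum_k v 0 k * pderiv k f (s *: v + x))
    (\sum_l v 0 l * \sum_k v 0 k * pderiv k (pderiv l f) x) _ (divr_gt0 d0 v1).
  rewrite scale0r add0r; apply.
  - by move=> s /near Ds; apply: directional_derivative_line.
  - have h l := @directional_derivative _ (fun y k => @f3 y k l) (fun y k => @f4 y k l) x v Dx.
    have := has_tderiv_sum (index_enum 'I_n) (fun l => has_tderivM (has_tderiv_cst _ (v 0 l) 0)
      (h l)).
    by congr has_tderiv; apply: eq_bigr => l _; rewrite mul0r add0r.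
  - by move=> s /near; exact: fmin.
split=> [k|v].
  have [+ _] := main 'e_k; rewrite (bigD1 k) //= mxE !eqxx mul1r big1 ?addr0 // => j jk.
  by rewrite mxE eqxx (negbTE jk) mul0r.
have [_] := main v; congr (_ <= _); rewrite mxE; apply: eq_bigr => l _.
by rewrite !mxE mulrC; congr (_ * _); apply: eq_bigr => k _; rewrite mxE.
Qed.

End SeveralVariables.

(** * Smooth families of functions *)

(** A time interval, possibly with end points but without isolated points, times an
    open set of coordinate space. *)
Record st_domain (R : realType) (n : nat) := StDomain {
  st_time : set R;
  st_space : set 'rV[R]_n;
  st_time_itv : is_interval st_time;
  st_time_acc : forall t, st_time t -> accumulation st_time t;
  st_space_open : open st_space }.

Section SmoothFamilies.
Variables (R : realType) (n : nat) (U : st_domain R n).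
Local Notation J := (st_time U).
Local Notation D := (st_space U).
Local Notation dir := (option 'I_n).
Implicit Types (F : R -> 'rV[R]_n -> R) (d : dir).

(** The four functions below describe the coordinate line through (t, x) in the direction
    [d], so that time and space derivatives are both derivatives [has_tderiv] of the
    restriction [on_line].  In the time direction the parameter is the time itself, so the
    base point is [t]; in a space direction it is the displacement, and the base point 0. *)
Definition line_dom d : set R := if d is None then J else setT.
Definition line_base d (t : R) : R := if d is None then t else 0.
Definition line_time d (t s : R) : R := if d is None then s else t.
Definition line_space d (x : 'rV[R]_n) (s : R) : 'rV[R]_n :=
  if d is Some k then s *: 'e_k + x else x.

Definition on_line d F t x s := F (line_time d t s) (line_space d x s).
Definition has_stderiv d F t x l :=
  has_tderiv (line_dom d) (on_line d F t x) (line_base d t) l.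

Lemma line_time_base d t : line_time d t (line_base d t) = t.
Proof. by case: d. Qed.

Lemma line_space_base d t x : line_space d x (line_base d t) = x.
Proof. by case: d => //= k; rewrite scale0r add0r. Qed.

Lemma on_line_base d F t x : on_line d F t x (line_base d t) = F t x.
Proof. by rewrite /on_line line_time_base line_space_base. Qed.

Lemma line_near d t x : J t -> D x -> exists2 e : R, 0 < e & forall s,
  line_dom d s -> `|s - line_base d t| < e -> J (line_time d t s) /\ D (line_space d x s).
Proof.
case: d => [k|] Jt Dx /=; last by exists 1.
have [e e0 he] := open_ballP (@st_space_open _ _ U) Dx.
have k1 : 0 < `|'e_k : 'rV[R]_n| + 1 by rewrite ltr_wpDl.
exists (e / (`|'e_k : 'rV[R]_n| + 1)); first by rewrite divr_gt0.
move=> s _; rewrite subr0 => se; split=> //; apply: he; rewrite addrK normrZ.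
by rewrite ltr_pdivlMr // in se; apply: le_lt_trans se; rewrite ler_wpM2l // lerDl.
Qed.

Lemma stderivable_has d F t x : stderivable J d F t x -> has_stderiv d F t x (stderiv J d F t x).
Proof.
case: d => [k|] /=; first exact: derivable_has_tderiv.
exact: tderivable_has.
Qed.

Lemma has_stderiv_stderivable d F t x l : J t -> has_stderiv d F t x l ->
  stderivable J d F t x /\ stderiv J d F t x = l.
Proof.
case: d => [k|] Jt /=; first exact: has_tderiv_derive.
by apply: has_tderiv_tderiv; exact: st_time_acc.
Qed.

Lemma line_dom_base d t : J t -> line_dom d (line_base d t).
Proof. by case: d. Qed.

Lemma has_stderiv_eq d F G t x l : J t -> D x ->
  (forall t x, J t -> D x -> F t x = G t x) -> has_stderiv d F t x l -> has_stderiv d G t x l.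
Proof.
move=> Jt Dx e; have [dl dl0 h] := line_near d Jt Dx.
apply: (has_tderiv_local dl0).
  by rewrite /on_line line_time_base line_space_base e.
by move=> s sd se; have [? ?] := h s sd se; apply: e.
Qed.

Definition st_continuous F := {within J `*` D, continuous (fun p => F p.1 p.2)}.

(** The closure of the smooth families under pointwise equality on the domain, ring
    operations and inverses.  Smoothness asks for all iterated derivatives, so products
    and inverses are treated coinductively: the class is stable under each derivation and
    consists of continuous, differentiable families, hence of smooth ones. *)
Inductive smooth_closure : (R -> 'rV[R]_n -> R) -> Prop :=
| closure_base F : smooth_family_on J D F -> smooth_closure F
| closure_eq F G : smooth_closure F -> (forall t x, J t -> D x -> F t x = G t x) ->
    smooth_closure G
| closure_cst c : smooth_closure (fun _ _ => c)
| closure_add F G : smooth_closure F -> smooth_closure G ->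
    smooth_closure (fun t x => F t x + G t x)
| closure_mul F G : smooth_closure F -> smooth_closure G ->
    smooth_closure (fun t x => F t x * G t x)
| closure_inv F : smooth_closure F -> (forall t x, J t -> D x -> F t x != 0) ->
    smooth_closure (fun t x => (F t x)^-1).

Lemma smooth_closure_step_of F d (F' : R -> 'rV[R]_n -> R) :
  (forall t x, J t -> D x -> has_stderiv d F t x (F' t x)) -> smooth_closure F' ->
  (forall t x, J t -> D x -> stderivable J d F t x) /\ smooth_closure (stderiv J d F).
Proof.
move=> h g; split=> [t x Jt Dx|]; first by have [] := has_stderiv_stderivable Jt (h t x Jt Dx).
apply: closure_eq g _ => t x Jt Dx; by have [_ ->] := has_stderiv_stderivable Jt (h t x Jt Dx).
Qed.

Lemma smooth_closure_step F : smooth_closure F -> st_continuous F /\ forall d,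
  (forall t x, J t -> D x -> stderivable J d F t x) /\ smooth_closure (stderiv J d F).
Proof.
elim=> {F}.
- move=> F sF; split; first by have [] := sF [::].
  move=> d; split; first by move=> t x Jt Dx; have [_] := sF [::]; apply.
  by apply: closure_base => s; have := sF (rcons s d); rewrite foldr_rcons.
- move=> F G gF [cF dF] e; split.
    apply: subspace_eq_continuous cF => -[t x]; rewrite inE /= => -[Jt Dx]; exact: e.
  move=> d; have [h1 h2] := dF d; apply: smooth_closure_step_of h2 => t x Jt Dx.
  by apply: has_stderiv_eq e _ => //; apply: stderivable_has; apply: h1.
- move=> c; split; first by apply/subspace_continuousP => x _; exact: cvg_cst.
  by move=> d; apply: (smooth_closure_step_of (F' := fun _ _ => 0)); 
    [move=> t x _ _; exact: has_tderiv_cst | exact: closure_cst].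
- move=> F G gF [cF dF] gG [cG dG]; split.
    move: cF cG => /subspace_continuousP cF /subspace_continuousP cG.
    by apply/subspace_continuousP => p Ap; apply: cvgD; [exact: cF | exact: cG].
  move=> d; have [h1 h2] := dF d; have [k1 k2] := dG d.
  apply: smooth_closure_step_of (closure_add h2 k2) => t x Jt Dx.
  by apply: has_tderivD; apply: stderivable_has; [exact: h1 | exact: k1].
- move=> F G gF [cF dF] gG [cG dG]; split.
    move: cF cG => /subspace_continuousP cF /subspace_continuousP cG.
    by apply/subspace_continuousP => p Ap; apply: cvgM; [exact: cF | exact: cG].
  move=> d; have [h1 h2] := dF d; have [k1 k2] := dG d.
  apply: smooth_closure_step_of (closure_add (closure_mul h2 gG) (closure_mul gF k2)) => t x Jt Dx.
  have := has_tderivM (stderivable_has (h1 _ _ Jt Dx)) (stderivable_has (k1 _ _ Jt Dx)).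
  by rewrite !on_line_base.
- move=> F gF [cF dF] F0; split.
    move: cF => /subspace_continuousP cF.
    apply/subspace_continuousP => p Ap; apply: cvgV; [by apply: F0; case: Ap | exact: cF].
  move=> d; have [h1 h2] := dF d; have gV := closure_inv gF F0.
  apply: smooth_closure_step_of (closure_mul (closure_cst (-1)) (closure_mul (closure_mul h2
    gV) gV)) => t x Jt Dx.
  have := has_tderivV (line_dom_base d Jt) _ (stderivable_has (h1 _ _ Jt Dx)).
  rewrite on_line_base mulN1r; apply; exact: F0.
Qed.

Lemma smooth_closure_smooth F : smooth_closure F -> smooth_family_on J D F.
Proof.
move=> gF s; have {gF} : smooth_closure (foldr (@stderiv R n J) F s).
  by elim: s => // d s IH; have [_ /(_ d)[]] := smooth_closure_step IH.
by move=> /smooth_closure_step[c h]; split=> // d t x Jt Dx; have [k _] := h d; apply: k.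
Qed.

Lemma smooth_st_continuous F : smooth_family_on J D F -> st_continuous F.
Proof. by move=> h; have [] := h [::]. Qed.

Lemma smooth_stderiv F d : smooth_family_on J D F -> smooth_family_on J D (stderiv J d F).
Proof. by move=> h s; have := h (rcons s d); rewrite foldr_rcons. Qed.

Lemma smooth_has_stderiv F d t x : smooth_family_on J D F -> J t -> D x ->
  has_stderiv d F t x (stderiv J d F t x).
Proof. by move=> h Jt Dx; apply: stderivable_has; have [_] := h [::]; apply. Qed.

Lemma st_continuous_eps F t x : st_continuous F -> J t -> D x ->
  forall e, 0 < e -> exists2 dl : R, 0 < dl & forall s y, J s -> D y ->
    `|s - t| < dl -> `|y - x| < dl -> `|F s y - F t x| < e.
Proof.
move=> /subspace_continuousP cF Jt Dx e e0.
have /cvgrPdist_lt/(_ _ e0) : (fun p => F p.1 p.2) @ within (J `*` D) (nbhs (t, x)) --> F t x.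
  by apply: (cF (t, x)).
rewrite near_withinE => /nbhs_ballP[dl /= dl0 h]; exists dl => // s y Js Dy st yx.
rewrite distrC; apply: (h (s, y)) => //; split => /=; rewrite -ball_normE /ball_ /= distrC //.
Qed.

Lemma has_stderiv_at d F t x a : smooth_family_on J D F ->
  J (line_time d t a) -> D (line_space d x a) ->
  has_tderiv (line_dom d) (on_line d F t x) a (stderiv J d F (line_time d t a) (line_space d x a)).
Proof.
move=> sF Jt Dx; have := smooth_has_stderiv d sF Jt Dx.
case: d Jt Dx => [k|] //= Jt Dx.
rewrite /has_stderiv /= -{1}(subrr a) => /has_tderiv_shift h.
apply: has_tderiv_eq h => // s _; rewrite /on_line /= addrA -scalerDl.
by congr (F t (_ *: _ + _)); ring.
Qed.

Lemma axis_shift_lt (k : 'I_n) (s e : R) : `|s| < e / (`|'e_k : 'rV[R]_n| + 1) ->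
  `|s *: ('e_k : 'rV[R]_n)| < e.
Proof.
have k1 : 0 < `|'e_k : 'rV[R]_n| + 1 by rewrite ltr_wpDl.
rewrite ltr_pdivlMr // => h; apply: le_lt_trans h.
by rewrite normrZ ler_wpM2l // lerDl.
Qed.

(** [schwarz] on a small rectangle spanned by the two coordinate lines through (t, x). *)
Lemma stderivC F d d' t x : smooth_family_on J D F -> J t -> D x ->
  stderiv J d (stderiv J d' F) t x = stderiv J d' (stderiv J d F) t x.
Proof.
move=> sF Jt Dx; have [->//|dd'] := eqVneq d d'.
pose T a b := line_time d (line_time d' t b) a.
pose X a b := line_space d (line_space d' x b) a.
have TE a b : T a b = line_time d' (line_time d t a) b.
  by move: dd'; rewrite /T; case: (d) => [k|]; case: (d').
have XE a b : X a b = line_space d' (line_space d x a) b.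
  move: dd'; rewrite /X; case: (d) => [k|]; case: (d') => [l|] //= _.
  by rewrite addrCA.
pose near_base c e := [set a | line_dom c a /\ `|a - line_base c t| < e].
have near2 (e : R) : 0 < e -> exists2 dl, 0 < dl & forall a b,
    near_base d dl a -> near_base d' dl b ->
    [/\ J (T a b), `|T a b - t| < e & `|X a b - x| < e].
  move=> e0; pose nk c := if c is Some k then `|'e_k : 'rV[R]_n| + 1 else 1.
  have nk0 c : 0 < nk c by case: c => //= k; rewrite ltr_wpDl.
  have e2 : 0 < e / 2 by rewrite divr_gt0.
  exists (Num.min e (Num.min (e / 2 / nk d) (e / 2 / nk d'))).
    by rewrite !lt_min e0 !divr_gt0.
  move=> a b [] + + [].
  move: dd'; rewrite /T /X /nk /line_base; case: (d) => [k|]; case: (d') => [l|] //= _;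
   rewrite ?subr0 !lt_min => Ja /and3P[ae a1 a2] Jb /and3P[be b1 b2].
  - split=> //; first by rewrite subrr normr0.
    rewrite addrA addrK (le_lt_trans (ler_normD _ _)) //.
    by have := axis_shift_lt a1; have := axis_shift_lt b2; lra.
  - split=> //; rewrite addrK; apply: axis_shift_lt; apply: lt_le_trans a1 _.
    by rewrite ler_wpM2r // ?invr_ge0 ?ltW ?(nk0 (Some k)) //; lra.
  - split=> //; rewrite addrK; apply: axis_shift_lt; apply: lt_le_trans b2 _.
    by rewrite ler_wpM2r // ?invr_ge0 ?ltW ?(nk0 (Some l)) //; lra.
have [e0 e00 De0] := open_ballP (@st_space_open _ _ U) Dx.
have [dl dl0 inside] := near2 _ e00.
pose A := near_base d dl; pose B := near_base d' dl.
have inJ a b : A a -> B b -> J (T a b) by move=> Aa Bb; have [] := inside a b Aa Bb.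
have inD a b : A a -> B b -> D (X a b) by move=> Aa Bb; have [_ _ /De0] := inside a b Aa Bb.
have itv c : is_interval (near_base c dl).
  move=> a b [la na] [lb nb] z zab; split; last by move: na nb; rewrite !ltr_norml; lra.
  by move: la lb; case: (c) => //= la lb; exact: (st_time_itv la lb).
have acc c : accumulation (near_base c dl) (line_base c t).
  move=> e ee; have m0 : 0 < Num.min dl e by rewrite lt_min dl0.
  have [s ls [st sm]] : exists2 s, line_dom c s & s != line_base c t /\ `|s - line_base c t| <
    Num.min dl e.
    case: c => [k|] /=; last exact: st_time_acc.
    by exists (Num.min dl e / 2) => //; rewrite subr0 gt_eqF ?divr_gt0 // gtr0_norm ?divr_gt0
      //; lra.
  by move: sm; rewrite lt_min => /andP[sm1 sm2]; exists s.
have Aa0 : A (line_base d t) by split; rewrite ?subrr ?normr0 //; exact: line_dom_base.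
have Bb0 : B (line_base d' t) by split; rewrite ?subrr ?normr0 //; exact: line_dom_base.
have T0 : T (line_base d t) (line_base d' t) = t.
  by rewrite TE line_time_base line_time_base.
have X0 : X (line_base d t) (line_base d' t) = x.
  by rewrite XE line_space_base line_space_base.
have sub c : near_base c dl `<=` line_dom c by move=> a [].
have dera G a b : smooth_family_on J D G -> A a -> B b ->
  has_tderiv A (fun a => G (T a b) (X a b)) a (stderiv J d G (T a b) (X a b)).
  move=> sG Aa Bb; apply: (has_tderiv_sub (@sub d)).
  exact: (has_stderiv_at sG (inJ a b Aa Bb) (inD a b Aa Bb)).
have derb G a b : smooth_family_on J D G -> A a -> B b ->
  has_tderiv B (fun b => G (T a b) (X a b)) b (stderiv J d' G (T a b) (X a b)).
  move=> sG Aa Bb; apply: (has_tderiv_sub (@sub d')).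
  have := inJ a b Aa Bb; have := inD a b Aa Bb; rewrite TE XE => h1 h2.
  have := has_stderiv_at sG h2 h1.
  by apply: has_tderiv_eq => [|s _]; [case: Bb | rewrite TE XE].
have cont G : smooth_family_on J D G -> forall e, 0 < e -> exists2 e', 0 < e' & forall a b,
   A a -> B b -> `|a - line_base d t| < e' -> `|b - line_base d' t| < e' ->
   `|G (T a b) (X a b) - G (T (line_base d t) (line_base d' t)) (X (line_base d t) (line_base
     d' t))| < e.
  move=> sG e ee; rewrite T0 X0.
  have [e1 e10 h1] := st_continuous_eps (smooth_st_continuous sG) Jt Dx ee.
  have [e2 e20 h2] := near2 _ e10; exists e2 => // a b Aa Bb ae be.
  have [] := h2 a b; [by split=> //; case: Aa | by split=> //; case: Bb|].
  by move=> JT Tt Xx; apply: h1 => //; exact: inD.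
have sd c G : smooth_family_on J D G -> smooth_family_on J D (stderiv J c G) by exact:
  smooth_stderiv.
have := @schwarz R A B (fun a b => F (T a b) (X a b))
  (fun a b => stderiv J d F (T a b) (X a b)) (fun a b => stderiv J d' F (T a b) (X a b))
  (fun a b => stderiv J d' (stderiv J d F) (T a b) (X a b))
  (fun a b => stderiv J d (stderiv J d' F) (T a b) (X a b))
  _ _ (itv d) (itv d') (acc d) (acc d') Aa0 Bb0.
rewrite T0 X0 => <- //.
- by move=> a b Aa Bb; apply: dera.
- by move=> a b Aa Bb; apply: derb.
- by move=> a b Aa Bb; apply: derb => //; exact: sd.
- by move=> a b Aa Bb; apply: dera => //; exact: sd.
- by have := cont _ (sd d' _ (sd d _ sF)); rewrite T0 X0.
- by have := cont _ (sd d _ (sd d' _ sF)); rewrite T0 X0.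
Qed.

End SmoothFamilies.

(** * The differential ring of smooth families *)

Section RingOfSmoothFamilies.
Variables (R : realType) (n : nat) (U : st_domain R n).
Local Notation J := (st_time U).
Local Notation D := (st_space U).

(** Families are restricted to the points of the domain before they are made into a
    ring: equality of ring elements is then equality on the domain, whatever the values
    outside. *)
Definition st_point := {p : R * 'rV[R]_n | J p.1 /\ D p.2}.

Definition extend (f : st_point -> R) (t : R) (x : 'rV[R]_n) : R :=
  if pselect (J t /\ D x) is left h then f (exist _ (t, x) h) else 0.

Definition restrict (F : R -> 'rV[R]_n -> R) : st_point -> R :=
  fun p => F (sval p).1 (sval p).2.

Lemma extendE f t x (h : J t /\ D x) : extend f t x = f (exist _ (t, x) h).
Proof.
rewrite /extend; case: pselect => // h'; congr (f (exist _ _ _)); exact: Prop_irrelevance.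
Qed.

Lemma restrictK F t x : J t -> D x -> extend (restrict F) t x = F t x.
Proof. by move=> Jt Dx; rewrite (extendE _ (conj Jt Dx)). Qed.

Definition smooth_pred : pred (st_point -> R) :=
  fun f => `[< smooth_family_on J D (extend f) >].

Lemma smooth_predP f : reflect (smooth_family_on J D (extend f)) (f \in smooth_pred).
Proof. exact: asboolP. Qed.

Lemma restrict_smooth F : smooth_closure U F -> restrict F \in smooth_pred.
Proof.
move=> h; apply/smooth_predP; apply: smooth_closure_smooth; apply: (closure_eq h) => t x Jt Dx.
by rewrite restrictK.
Qed.

Lemma smooth_subring_closed : subring_closed smooth_pred.
Proof.
split.
- have -> : 1 = restrict (fun _ _ => 1) :> (st_point -> R) by apply/funext.
  exact/restrict_smooth/closure_cst.
- move=> f g /smooth_predP/closure_base gf /smooth_predP/closure_base gg.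
  have -> : f - g = restrict (fun t x => extend f t x + -1 * extend g t x).
    apply/funext => -[[t x] h].
    by rewrite /restrict /= !(extendE _ h) mulN1r.
  exact: restrict_smooth (closure_add gf (closure_mul (closure_cst U (-1)) gg)).
- move=> f g /smooth_predP/closure_base gf /smooth_predP/closure_base gg.
  have -> : f * g = restrict (fun t x => extend f t x * extend g t x).
    apply/funext => -[[t x] h].
    by rewrite /restrict /= !(extendE _ h).
  exact: restrict_smooth (closure_mul gf gg).
Qed.

Record smooth_fun := SmoothFun { smooth_val :> st_point -> R; _ : smooth_val \in smooth_pred }.
HB.instance Definition _ := [isSub for smooth_val].
HB.instance Definition _ := [Choice of smooth_fun by <:].
HB.instance Definition _ := GRing.SubChoice_isSubComPzRing.Build _ _ smooth_fun
  smooth_subring_closed.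

Implicit Types f g : smooth_fun.

Lemma smooth_funP f : smooth_family_on J D (extend f).
Proof. by case: f => f /= /smooth_predP. Qed.

Lemma deriv_in d f : restrict (stderiv J d (extend f)) \in smooth_pred.
Proof.
by apply: restrict_smooth; apply: closure_base; apply: smooth_stderiv; exact: smooth_funP.
Qed.

Definition sderiv d f : smooth_fun := SmoothFun (deriv_in d f).

Lemma smooth_fun_eq f g : (forall t x, J t -> D x -> extend f t x = extend g t x) -> f = g.
Proof.
move=> e; apply/val_inj/funext => -[[t x] h] /=.
by have := e _ _ h.1 h.2; rewrite !(extendE _ h).
Qed.

Section Eval.
Variables (t : R) (x : 'rV[R]_n) (Jt : J t) (Dx : D x).

Definition eval f := extend f t x.
Lemma evalE f : eval f = f (exist _ (t, x) (conj Jt Dx)).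
Proof. exact: extendE. Qed.

Lemma evalD f g : eval (f + g) = eval f + eval g. Proof. by rewrite !evalE. Qed.

Lemma evalM f g : eval (f * g) = eval f * eval g. Proof. by rewrite !evalE. Qed.

Lemma evalN f : eval (- f) = - eval f. Proof. by rewrite !evalE. Qed.

End Eval.

Lemma sderivE d f t x : J t -> D x -> extend (sderiv d f) t x = stderiv J d (extend f) t x.
Proof. by move=> Jt Dx; rewrite restrictK. Qed.

Lemma sderiv_zmod d : zmod_morphism (sderiv d).
Proof.
move=> f g; apply: smooth_fun_eq => t x Jt Dx.
rewrite -[RHS]/(eval t x _) (evalD Jt Dx) (evalN Jt Dx) /eval !sderivE //.
have := has_tderivD (smooth_has_stderiv d (smooth_funP f) Jt Dx)
  (has_tderivM (has_tderiv_cst _ (-1) _) (smooth_has_stderiv d (smooth_funP g) Jt Dx)).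
rewrite mul0r add0r mulN1r => h.
suff /(has_stderiv_stderivable Jt)[_ ->] : has_stderiv U d (extend (f - g)) t x
  (stderiv J d (extend f) t x - stderiv J d (extend g) t x) by [].
apply: (has_stderiv_eq (F := fun t x => extend f t x + -1 * extend g t x)) h => // s y Js Dy.
by rewrite -[RHS]/(eval s y _) (evalD Js Dy) (evalN Js Dy) mulN1r.
Qed.

HB.instance Definition _ d := GRing.isZmodMorphism.Build smooth_fun smooth_fun (sderiv d)
  (sderiv_zmod d).

Lemma sderivM d f g : sderiv d (f * g) = sderiv d f * g + f * sderiv d g.
Proof.
apply: smooth_fun_eq => t x Jt Dx.
rewrite -[RHS]/(eval t x _) (evalD Jt Dx) !(evalM Jt Dx) /eval !sderivE //.
have := has_tderivM (smooth_has_stderiv d (smooth_funP f) Jt Dx)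
  (smooth_has_stderiv d (smooth_funP g) Jt Dx).
rewrite !on_line_base => h.
suff /(has_stderiv_stderivable Jt)[_ ->] : has_stderiv U d (extend (f * g)) t x
  (stderiv J d (extend f) t x * extend g t x + extend f t x * stderiv J d (extend g) t x) by [].
apply: (has_stderiv_eq (F := fun t x => extend f t x * extend g t x)) h => // s y Js Dy.
by rewrite -[RHS]/(eval s y _) (evalM Js Dy).
Qed.

Lemma stderiv_eq d F G t x : J t -> D x -> smooth_family_on J D F ->
  (forall t x, J t -> D x -> F t x = G t x) -> stderiv J d F t x = stderiv J d G t x.
Proof.
move=> Jt Dx sF e; have h := has_stderiv_eq Jt Dx e (smooth_has_stderiv d sF Jt Dx).
by have [_ ->] := has_stderiv_stderivable Jt h.
Qed.

Lemma sderivC d d' f : sderiv d (sderiv d' f) = sderiv d' (sderiv d f).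
Proof.
apply: smooth_fun_eq => t x Jt Dx; rewrite !sderivE //.
have E c c' : stderiv J c (extend (sderiv c' f)) t x = stderiv J c (stderiv J c' (extend f)) t x.
  apply: stderiv_eq => //; first exact: smooth_funP.
  by move=> s y Js Dy; rewrite sderivE.
by rewrite !E; apply: stderivC => //; exact: smooth_funP.
Qed.

End RingOfSmoothFamilies.

(** * The evolution of S in a chart *)

Section LocalFlow.
Variables (R : realType) (n : nat) (U : st_domain R n).
Local Notation J := (st_time U).
Local Notation D := (st_space U).
Local Notation K := (smooth_fun U).

(** The derivation packaged as an additive map, the form in which the algebraic part
    takes it. *)
Definition derivation e : {additive K -> K} := sderiv (U := U) e.
Arguments derivation : simpl never.
Local Notation d := derivation.

Definition value_at (p : st_point U) (f : K) : R := f p.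
Arguments value_at : simpl never.
Lemma value_at_zmod p : zmod_morphism (value_at p). Proof. by []. Qed.

Lemma value_at_monoid p : monoid_morphism (value_at p). Proof. by []. Qed.

HB.instance Definition _ p := GRing.isZmodMorphism.Build K R (value_at p) (value_at_zmod p).
HB.instance Definition _ p := GRing.isMonoidMorphism.Build K R (value_at p) (value_at_monoid p).

Definition to_smooth F (sF : smooth_closure U F) : K := SmoothFun (restrict_smooth sF).

Lemma value_at_to_smooth p F (sF : smooth_closure U F) : value_at p (to_smooth sF) = 
  F (sval p).1 (sval p).2.
Proof. by []. Qed.

(** The dictionary between the ring of smooth families and the coordinate expressions in
    the definition of the flow; it is compatible with all operations and with derivatives. *)
Definition represents (f : K) F := forall p : st_point U, value_at p f = F (sval p).1 (sval p).2.

Lemma represents_extend f F t x : represents f F -> J t -> D x -> extend f t x = F t x.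
Proof. by move=> h Jt Dx; rewrite (extendE _ (conj Jt Dx)); apply: h. Qed.

Lemma represents_smooth f F : represents f F -> smooth_family_on J D F.
Proof.
move=> h; apply: smooth_closure_smooth; apply: closure_eq (closure_base (smooth_funP f)) _ => t x.
exact: represents_extend.
Qed.

Lemma represents_sderiv e f F : represents f F -> represents (d e f) (stderiv J e F).
Proof.
move=> h [[t x] [/= Jt Dx]]; change (stderiv J e (extend f) t x = stderiv J e F t x).
by apply: stderiv_eq => //; [exact: smooth_funP | move=> s y; exact: represents_extend].
Qed.

Lemma represents_eq f g F : represents f F -> represents g F -> f = g.
Proof.
by move=> hf hg; apply/val_inj/funext => p; have := hf p; rewrite -hg.
Qed.

Section CurvatureOfRepresented.
Variables (g : R -> 'rV[R]_n -> 'M[R]_n) (u : R -> 'rV[R]_n -> R) (alpha : R).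
Variables (P : 'M[K]_n) (Gam : 'I_n -> 'M[K]_n) (v al : K).
Hypothesis represents_inverse_metric : forall a b,
  represents (P a b) (fun t x => invmx (g t x) a b).
Hypothesis represents_christoffel : forall i k j,
  represents (Gam i k j) (fun t => christoffel (g t) k i j).
Hypothesis represents_scalar : represents v u.
Hypothesis represents_coupling : represents al (fun _ _ => alpha).

Lemma represents_curvature i j l k : represents (curvature d Gam i j l k)
  (fun t => riemann (g t) l i j k).
Proof.
move=> p; rewrite curvatureE rmorphD rmorphB /= !(represents_sderiv _ (represents_christoffel _
  _ _) p).
congr (_ + _); rewrite rmorph_sum; apply: eq_bigr => m _.
by rewrite rmorphB !rmorphM /= !(represents_christoffel _ _ _ p).
Qed.

Lemma represents_ricci j k : represents (ricci_form d Gam j k) (fun t => ricci (g t) j k).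
Proof.
by move=> p; rewrite mxE rmorph_sum; apply: eq_bigr => i _; rewrite /= (represents_curvature _
  _ _ _ p).
Qed.

Lemma represents_laplace f F : represents f F -> 
  represents (laplace d P Gam f) (fun t => laplacian (g t) (F t)).
Proof.
move=> hf p; rewrite rmorph_sum; apply: eq_bigr => i _; rewrite rmorph_sum.
apply: eq_bigr => j _; rewrite rmorphM rmorphB rmorph_sum /= (represents_inverse_metric _ _ p);
  congr (_ * (_ - _)).
  by rewrite (represents_sderiv _ (represents_sderiv _ hf) p).
by apply: eq_bigr => k _; rewrite rmorphM /= (represents_christoffel _ _ _ p)
  (represents_sderiv _ hf p).
Qed.

Lemma represents_List_form i j : represents (List_form d Gam al v i j)
  (fun t => List_tensor alpha (g t) (u t) i j).
Proof.
move=> p; rewrite mxE rmorphB !rmorphM /= (represents_ricci _ _ p).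
by rewrite (represents_coupling p) !(represents_sderiv _ represents_scalar p).
Qed.

Lemma represents_List_trace : represents (List_trace d P Gam al v)
  (fun t => List_scalar alpha (g t) (u t)).
Proof.
move=> p; rewrite rmorph_sum; apply: eq_bigr => i _; rewrite rmorph_sum.
by apply: eq_bigr => j _; rewrite rmorphM /= (represents_inverse_metric _ _ p)
  (represents_List_form _ _ p).
Qed.

End CurvatureOfRepresented.

Section Flow.
Variables (g : R -> 'rV[R]_n -> 'M[R]_n) (u : R -> 'rV[R]_n -> R) (alpha : R) (r : R -> R).
Hypothesis n_gt0 : (0 < n)%N.
Hypothesis alpha_gt0 : 0 < alpha.
Hypothesis g_smooth : forall a b, smooth_family_on J D (fun t x => g t x a b).
Hypothesis g_posdef : forall t x, J t -> D x -> posdef (g t x).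
Hypothesis u_smooth : smooth_family_on J D u.
Hypothesis flow_g : forall t x, J t -> D x -> forall a b,
  tderiv J (fun s => g s x a b) t =
    - 2 * (List_tensor alpha (g t) (u t) a b x - r t / n%:R * g t x a b).
Hypothesis flow_u : forall t x, J t -> D x -> tderiv J (u^~ x) t = laplacian (g t) (u t) x.

Let S t x := List_scalar alpha (g t) (u t) x.

Let G : 'M[K]_n := \matrix_(a, b) to_smooth (closure_base (g_smooth a b)).
Let v : K := to_smooth (closure_base u_smooth).

Lemma value_at_metric p : map_mx (value_at p) G = g (sval p).1 (sval p).2.
Proof. by apply/matrixP => a b; rewrite !mxE. Qed.

Lemma det_smooth : smooth_closure U (fun t x => \det (g t x)).
Proof.
apply: closure_eq (closure_base (smooth_funP (\det G))) _ => t x Jt Dx.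
rewrite (extendE _ (conj Jt Dx)) -[LHS]/(value_at (exist _ (t, x) (conj Jt Dx)) (\det G)).
by rewrite -det_map_mx value_at_metric.
Qed.

Lemma det_neq0 t x : J t -> D x -> \det (g t x) != 0.
Proof. by move=> Jt Dx; rewrite -unitfE -unitmxE posdef_unit //; exact: g_posdef. Qed.

Let P : 'M[K]_n := to_smooth (closure_inv det_smooth det_neq0) *: \adj G.

Lemma det_inv : to_smooth (closure_inv det_smooth det_neq0) * \det G = 1.
Proof.
apply/val_inj/funext => -[[t x] h]; set p := exist _ _ _.
rewrite -[LHS]/(value_at p _) rmorphM -[val 1 p]/(1 : R) /= -det_map_mx value_at_metric.
by rewrite value_at_to_smooth mulVf //; case: (h) => Jt Dx; exact: det_neq0.
Qed.

Lemma inverse_metricK : P *m G = 1%:M.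
Proof. by rewrite /P -scalemxAl mul_adj_mx scale_scalar_mx det_inv. Qed.

Lemma metricK : G *m P = 1%:M.
Proof. by rewrite /P -scalemxAr mul_mx_adj scale_scalar_mx det_inv. Qed.

Lemma value_at_inverse_metric p : map_mx (value_at p) P = invmx (g (sval p).1 (sval p).2).
Proof.
have h := congr1 (map_mx (value_at p)) inverse_metricK; rewrite map_mxM map_mx1 /=
  value_at_metric in h.
have [_ gu] := mulmx1_unit h.
by rewrite -[LHS]mulmx1 -(mulmxV gu) mulmxA h mul1mx.
Qed.

Lemma metric_symmetric : G^T = G.
Proof.
apply/matrixP => a b; rewrite !mxE; apply/val_inj/funext => -[[t x] [Jt Dx]].
have [gs _] := g_posdef Jt Dx.
by rewrite /= /restrict /= -{1}gs mxE.
Qed.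

Let half : K := to_smooth (closure_cst U 2^-1).
Lemma half_half : 2 * half = 1.
Proof.
apply/val_inj/funext => p; rewrite -[LHS]/(value_at p _) rmorphM rmorph_nat.
by rewrite -[RHS]/(1 : R) /half /= value_at_to_smooth mulfV ?pnatr_eq0.
Qed.

Let Gam := levi_civita d G P half.

Let torsion i a b : Gam i a b = Gam b a i.
Proof. exact/levi_civita_torsion_free/metric_symmetric. Qed.
Let compat i : map_mx (d (Some i)) G = (Gam i)^T *m G + G *m Gam i.
Proof. exact: (levi_civita_metric_compat _ metricK metric_symmetric half_half). Qed.

Lemma represents_metric a b : represents (G a b) (fun t x => g t x a b).
Proof. by move=> p; rewrite mxE. Qed.

Lemma represents_scalar : represents v u. Proof. by []. Qed.

Lemma represents_inverse_metric a b : represents (P a b) (fun t x => invmx (g t x) a b).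
Proof. by move=> p; rewrite -value_at_inverse_metric [in RHS]mxE. Qed.

Lemma represents_christoffel i k j : represents (Gam i k j) (fun t => christoffel (g t) k i j).
Proof.
move=> p; rewrite mxE rmorphM rmorph_sum; congr (_ * _); apply: eq_bigr => l _.
rewrite rmorphM rmorphB rmorphD /= (represents_inverse_metric k l p).
by rewrite !(represents_sderiv _ (represents_metric _ _) p).
Qed.

Let al : K := to_smooth (closure_cst U alpha).

Let represents_S : represents (List_trace d P Gam al v) S.
Proof.
by apply: represents_List_trace; [exact: represents_inverse_metric
  | exact: represents_christoffel | exact: represents_scalar |].
Qed.

Lemma List_scalar_smooth : smooth_family_on J D S.
Proof. exact: represents_smooth represents_S. Qed.

Lemma d_cst_smooth c e : d e (to_smooth (closure_cst U c)) = 0.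
Proof.
apply: (@represents_eq _ _ (fun _ _ => 0)) => // p.
rewrite (represents_sderiv _ (F := fun _ _ => c)) //; case: p => -[t x] [/= Jt Dx].
by have [_ ->] := has_stderiv_stderivable (d := e) (x := x) Jt (has_tderiv_cst _ c _).
Qed.

Let c : K := to_smooth (closure_cst U n%:R^-1) *
  (\tr (P *m map_mx (d None) G) + 2 * List_trace d P Gam al v).

(** The trace of the flow equation, where tr ((r / n) g) = r because n > 0. *)
Lemma trace_dt_metric t x : J t -> D x ->
  \tr (invmx (g t x) *m \matrix_(a, b) tderiv J (fun s => g s x a b) t) = - 2 * S t x + 2 * r t.
Proof.
move=> Jt Dx; have gu : g t x \in unitmx by apply: posdef_unit; exact: g_posdef.
have -> : \matrix_(a, b) tderiv J (fun s => g s x a b) t =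
   (- 2) *: (\matrix_(a, b) List_tensor alpha (g t) (u t) a b x) + (2 * (r t / n%:R)) *: g t x.
  by apply/matrixP => a b; rewrite !mxE flow_g //; ring.
rewrite mulmxDr -!scalemxAr mulVmx // mxtraceD !mxtraceZ mxtrace1; congr (_ * _ + _).
  have Psym : (invmx (g t x))^T = invmx (g t x).
    by rewrite trmx_inv; have [-> _] := g_posdef Jt Dx.
  rewrite /S /List_scalar exchange_big; apply: eq_bigr => i _; rewrite mxE.
  by apply: eq_bigr => j _; rewrite [in LHS]mxE -{1}Psym mxE.
by rewrite -mulrA divfK // pnatr_eq0 -lt0n.
Qed.

Lemma represents_rescaling : represents c (fun t _ => 2 * (r t / n%:R)).
Proof.
move=> p; rewrite rmorphM rmorphD rmorphM rmorph_nat /= (represents_S p).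
have -> : value_at p (\tr (P *m map_mx (d None) G)) = - 2 * S (sval p).1 (sval p).2 + 2 * r
  (sval p).1.
  case: p => -[t x] [Jt Dx] /=; rewrite -trace_dt_metric //; set p := exist _ _ _.
  rewrite -[LHS]/(value_at p _) -trace_map_mx map_mxM value_at_inverse_metric /=; congr (\tr (_
    *m _)).
  by apply/matrixP => a b; rewrite mxE [X in value_at p X]mxE [RHS]mxE (represents_sderiv _
    (represents_metric _ _) p).
by rewrite value_at_to_smooth; ring.
Qed.

(** The traced flow equation expresses r by smooth functions:
    2 r = tr (g^-1 dg/dt) + 2 S. *)
Lemma rescaling_factor_smooth : smooth_family_on J D (fun t _ => 2 * (r t / n%:R)).
Proof. exact: represents_smooth represents_rescaling. Qed.

(** The terms 2 |S_ij|^2 and 2 alpha (Lap phi)^2 of [dt_List_trace] are nonnegative. *)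
Lemma List_scalar_evolution t x : J t -> D x ->
  laplacian (g t) (S t) x - 2 * (r t / n%:R) * S t x <= tderiv J (S^~ x) t.
Proof.
move=> Jt Dx; pose p : st_point U := exist _ (t, x) (conj Jt Dx).
have d_al e : d e al = 0 by exact: d_cst_smooth.
have d_c i : d (Some i) c = 0.
  apply: (@represents_eq _ _ (fun _ _ => 0)) => // q.
  by rewrite (represents_sderiv _ represents_rescaling) /stderiv /pderiv derive_cst.
have fg : map_mx (d None) G = \matrix_(i, j) (- 2 * List_form d Gam al v i j + c * G i j).
  apply/matrixP => a b; rewrite [LHS]mxE [RHS]mxE.
  apply: (represents_eq (represents_sderiv None (represents_metric a b))) => -[[s y] [Js Dy]].
  set q := exist _ _ _; rewrite rmorphD [X in X + _]rmorphM [X in _ + X]rmorphM rmorphN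
    rmorph_nat /= (represents_rescaling q) (represents_metric a b q).
  rewrite (@represents_List_form g u alpha Gam v al) //; last exact: represents_christoffel.
  by rewrite /= flow_g //; ring.
have fu : d None v = laplace d P Gam v.
  apply: (represents_eq (represents_sderiv None represents_scalar)) => q.
  rewrite (represents_laplace represents_inverse_metric represents_christoffel represents_scalar q).
  by case: q => -[s y] [Js Dy] /=; rewrite flow_u.
have := dt_List_trace (@sderivM _ _ U) (@sderivC _ _ U) inverse_metricK metricK
  metric_symmetric torsion compat d_al d_c fg fu.
move=> /(congr1 (value_at p)).
rewrite (represents_sderiv None represents_S p) /=.
rewrite !rmorphD rmorphN !(rmorphM (value_at p) c) (rmorphM (value_at p) 2) (rmorphM (value_at
  p) (2 * al)) (rmorphM (value_at p) 2 al) !rmorph_nat rmorphXn /=.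
rewrite (represents_laplace represents_inverse_metric represents_christoffel represents_S p)
  (represents_S p) (represents_rescaling p) value_at_to_smooth /=.
set q := value_at p (\tr _) => ->.
have q_ge0 : 0 <= q.
  rewrite /q -trace_map_mx !map_mxM value_at_inverse_metric -map_trmx /=.
  by apply: mxtrace_posdef_inv_sq_ge0 (g_posdef Jt Dx) _ _; rewrite mulVmx // posdef_unit //;
    exact: g_posdef.
have : 0 <= 2 * alpha * value_at p (laplace d P Gam v) ^+ 2.
  by rewrite mulr_ge0 ?sqr_ge0 // mulr_ge0 // ltW.
lra.
Qed.

End Flow.

End LocalFlow.

(** * The Laplacian at a minimum *)

Section SpaceRegularity.
Variables (R : realType) (n : nat) (U : st_domain R n).
Local Notation J := (st_time U).
Local Notation D := (st_space U).

Lemma smooth_space_derivable F t y (k : 'I_n) : smooth_family_on J D F -> J t -> D y ->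
  derivable (F t) y 'e_k.
Proof. by move=> sF Jt Dy; have [_ /(_ (Some k) t y Jt Dy)] := sF [::]. Qed.

Lemma smooth_space_continuous F t y : smooth_family_on J D F -> J t -> D y ->
  {for y, continuous (F t)}.
Proof.
move=> sF Jt Dy; suff h0 : F t z @[z --> nbhs y] --> F t y by exact: h0.
apply/cvgrPdist_lt => e e0.
have [d d0 h] := st_continuous_eps (smooth_st_continuous sF) Jt Dy e0.
have [d' d'0 h'] := open_ballP (@st_space_open _ _ U) Dy.
apply/nbhs_ballP; exists (Num.min d d') => /=; first by rewrite lt_min d0.
move=> z; rewrite -ball_normE /ball_ /= distrC lt_min => /andP[z1 z2].
by rewrite distrC; apply: h => //; [exact: h' | rewrite subrr normr0].
Qed.

(** At a minimum the first derivatives vanish, which removes the Christoffel terms, and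
    the remaining contraction of the Hessian with the inverse metric is nonnegative. *)
Lemma laplacian_min_ge0 F t x (g : 'rV[R]_n -> 'M[R]_n) : smooth_family_on J D F ->
  J t -> D x -> posdef (g x) -> (forall y, D y -> F t x <= F t y) ->
  0 <= laplacian g (F t) x.
Proof.
move=> sF Jt Dx gpd Fmin.
have s1 k := smooth_stderiv (U := U) (Some k) sF.
have s2 k l := smooth_stderiv (U := U) (Some k) (s1 l).
have [D1 D2] : (forall k, pderiv k (F t) x = 0) /\
  forall v : 'rV[R]_n, 0 <= (v *m (\matrix_(k, l) pderiv k (pderiv l (F t)) x) *m v^T) 0 0.
  apply: (local_min_Hessian (@st_space_open _ _ U)) => // [y k|y k|y k l|y k l] Dy.
  - exact: smooth_space_derivable.
  - exact: (smooth_space_continuous (s1 k) Jt Dy).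
  - exact: (@smooth_space_derivable (stderiv J (Some l) F) t y k (s1 l) Jt Dy).
  - exact: (smooth_space_continuous (s2 k l) Jt Dy).
set H := \matrix_(k, l) _ in D2.
have -> : laplacian g (F t) x = \tr (invmx (g x) *m H^T).
  apply: eq_bigr => i _; rewrite mxE; apply: eq_bigr => j _; rewrite !mxE.
  by rewrite [X in _ - X]big1 ?subr0 // => k _; rewrite D1 mulr0.
apply: (mxtrace_posdef_inv_ge0 gpd); first by rewrite mulVmx // posdef_unit.
move=> v; have := D2 v.
have -> : v *m H^T *m v^T = (v *m H *m v^T)^T by rewrite !trmx_mul trmxK mulmxA.
by rewrite [X in _ -> _ <= X]mxE.
Qed.

End SpaceRegularity.

(** * Independence of the chart *)

(** Invariance of the trace of a bilinear form with respect to another under a change of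
    basis. *)
Lemma trace_congruence (R : comUnitRingType) n (A Q H : 'M[R]_n) :
  A *m Q *m A^T \in unitmx ->
  \tr (invmx (A *m Q *m A^T) *m (A *m H *m A^T)) = \tr (invmx Q *m H).
Proof.
move=> u; set P := invmx _.
have h : A *m (Q *m A^T *m P) = 1%:M by rewrite !mulmxA mulmxV.
have {}h : Q *m (A^T *m P *m A) = 1%:M by rewrite !mulmxA (mulmx1C h).
have Qu : Q \in unitmx by have [] := mulmx1_unit h.
have -> : invmx Q = A^T *m P *m A by rewrite -[LHS]mulmx1 -h (mulmxA _ Q) mulVmx // mul1mx.
by rewrite !mulmxA mxtrace_mulC !mulmxA.
Qed.

Section Flow.
Variables (R : realType) (n : nat) (n_gt0 : (0 < n)%N) (M : topologicalType).
Variables (A : smooth_manifold R n M) (M_compact : compact [set: M]).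
Variables (alpha : R) (alpha_gt0 : 0 < alpha) (J : set R) (J_itv : is_interval J).
Hypothesis J_acc : forall t, J t -> accumulation J t.
Variables (g : metric_family A J) (phi : R -> M -> R).
Hypothesis phi_smooth : smooth_scalar_family A J phi.
Variables (r : R -> R).
Hypothesis flow : rescaled_List_flow alpha r g phi.

Definition chart_domain (i : chart_index A) : st_domain R n :=
  StDomain J_itv J_acc (@chart_img_open _ _ _ A i).

Definition S_chart (i : chart_index A) t x :=
  List_scalar alpha (g i t) (fun y => phi t (chart_inv i y)) x.

Lemma chart_img_in (i : chart_index A) p : chart_dom i p -> chart_img i (chart i p).
Proof. by move=> ip; exists p. Qed.

Lemma metric_is_posdef (i : chart_index A) t x : J t -> chart_img i x -> posdef (g i t x).
Proof.
move=> Jt Dx.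
by split; [exact: (Defs.metric_sym g Jt Dx) | exact: (metric_posdef g Jt Dx)].
Qed.

Lemma S_chart_smooth i : smooth_family_on J (chart_img i) (S_chart i).
Proof.
exact: (@List_scalar_smooth _ _ (chart_domain i) (g i) _ alpha (@metric_smooth _ _ _ _ _ g i)
  (@metric_is_posdef i) (phi_smooth i)).
Qed.

Lemma rescaling_smooth (i : chart_index A) :
  smooth_family_on J (chart_img i) (fun t (_ : 'rV[R]_n) => 2 * (r t / n%:R)).
Proof.
apply: (@rescaling_factor_smooth _ _ (chart_domain i) (g i) _ alpha r n_gt0 (@metric_smooth _ _
  _ _ _ g i) (@metric_is_posdef i) (phi_smooth i)).
by move=> t x Jt Dx a b; have [h _] := flow Jt Dx; apply: h.
Qed.

Lemma S_chart_evolution i t x : J t -> chart_img i x ->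
  laplacian (g i t) (S_chart i t) x - 2 * (r t / n%:R) * S_chart i t x
    <= tderiv J (S_chart i ^~ x) t.
Proof.
apply: (@List_scalar_evolution _ _ (chart_domain i) (g i) _ alpha r n_gt0 alpha_gt0
  (@metric_smooth _ _ _ _ _ g i) (@metric_is_posdef i) (phi_smooth i)).
- by move=> s y Js Dy a b; have [h _] := flow Js Dy; apply: h.
- by move=> s y Js Dy; have [_ ] := flow Js Dy.
Qed.

Lemma S_chart_trace i t x : J t -> chart_img i x ->
  \tr (invmx (g i t x) *m \matrix_(a, b) tderiv J (fun s => g i s x a b) t) =
  - 2 * S_chart i t x + 2 * r t.
Proof.
apply: (@trace_dt_metric _ _ (chart_domain i) (g i) (fun t y => phi t (chart_inv i y)) alpha r
  n_gt0 (@metric_is_posdef i)).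
by move=> s y Js Dy a b; have [h _] := flow Js Dy; apply: h.
Qed.

(** The matrices of g in two charts are related by a Jacobian that does not depend on
    time, so their time derivatives are related in the same way, and S is recovered from
    the trace of dg/dt with respect to g by [S_chart_trace]. *)
Lemma S_chart_independent (i j : chart_index A) t p : J t -> chart_dom i p -> chart_dom j p ->
  S_chart i t (chart i p) = S_chart j t (chart j p).
Proof.
move=> Jt ip jp; have Di := chart_img_in ip; have Dj := chart_img_in jp.
pose B : 'M[R]_n := \matrix_(a, c) pderiv a (fun y => chart j (chart_inv i y) 0 c) (chart i p).
have gE s : J s -> g i s (chart i p) = B *m g j s (chart j p) *m B^T.
  move=> Js; apply/matrixP => a b; rewrite (metric_tensorial g Js ip jp) mxE.
  rewrite exchange_big; apply: eq_bigr => e _; rewrite mxE mulr_suml.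
  by apply: eq_bigr => c _; rewrite !mxE mulrAC.
(* [B] is constant in time, so differentiating [gE] only affects the middle factor. *)
have dgE : \matrix_(a, b) tderiv J (fun s => g i s (chart i p) a b) t =
   B *m (\matrix_(a, b) tderiv J (fun s => g j s (chart j p) a b) t) *m B^T.
  apply/matrixP => a b; rewrite mxE.
  suff h : has_tderiv J (fun s => g i s (chart i p) a b) t
      ((B *m (\matrix_(a, b) tderiv J (fun s => g j s (chart j p) a b) t) *m B^T) a b).
    by have [_] := has_tderiv_tderiv (J_acc Jt) h.
  have : has_tderiv J (fun s => \sum_e \sum_c (B a c * B b e) * g j s (chart j p) c e) t
      (\sum_e \sum_c (0 * g j t (chart j p) c e + (B a c * B b e) * tderiv J (fun s => g j s
        (chart j p) c e) t)).
    apply: has_tderiv_sum => e; apply: has_tderiv_sum => c; apply: has_tderivM.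
      exact: has_tderiv_cst.
    by apply: tderivable_has; have [_ /(_ None t _ Jt Dj)] := metric_smooth g j c e [::].
  have -> : \sum_e \sum_c (0 * g j t (chart j p) c e + (B a c * B b e) * tderiv J (fun s => g j
    s (chart j p) c e) t) =
     (B *m (\matrix_(a, b) tderiv J (fun s => g j s (chart j p) a b) t) *m B^T) a b.
    rewrite [RHS]mxE; apply: eq_bigr => e _; rewrite [X in _ = X * _]mxE mulr_suml.
    apply: eq_bigr => c _; rewrite [B^T _ _]mxE [(\matrix_(_, _) tderiv _ _ _) _ _]mxE; ring.
  apply: has_tderiv_eq => // s Js; rewrite gE // [RHS]mxE; apply: eq_bigr => e _.
  rewrite [X in _ = X * _]mxE mulr_suml; apply: eq_bigr => c _; rewrite [B^T _ _]mxE; ring.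
have := S_chart_trace Jt Di; rewrite dgE gE // trace_congruence; last first.
  by rewrite -gE //; apply: posdef_unit; exact: metric_is_posdef.
rewrite S_chart_trace //; lra.
Qed.

(** * The maximum principle on a compact manifold *)

Definition chart_at (p : M) : chart_index A := sval (cid (chart_cover A p)).
Lemma chart_at_dom p : chart_dom (chart_at p) p.
Proof. exact: svalP (cid (chart_cover A p)). Qed.

Definition S_global t p := S_chart (chart_at p) t (chart (chart_at p) p).

Lemma S_globalE i t p : J t -> chart_dom i p -> S_global t p = S_chart i t (chart i p).
Proof. by move=> Jt ip; apply: S_chart_independent => //; exact: chart_at_dom. Qed.

Lemma chart_continuous_at (i : chart_index A) p : chart_dom i p ->
  chart i q @[q --> nbhs p] --> chart i p.
Proof.
move=> ip; have /subspace_continuousP/(_ p ip) := @chart_continuous _ _ _ A i.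
rewrite within_interior //; have := @chart_dom_open _ _ _ A i.
by rewrite openE; apply.
Qed.

Lemma S_global_continuous B : B `<=` J ->
  {within B `*` [set: M], continuous (fun z => S_global z.1 z.2)}.
Proof.
move=> BJ; apply/subspace_continuousP => -[t p] [/= Bt _].
have Jt := BJ t Bt; pose i := chart_at p; have ip : chart_dom i p := chart_at_dom p.
have Dx := chart_img_in ip.
apply/cvgrPdist_lt => e e0; rewrite near_withinE.
have [dl dl0 h] := @st_continuous_eps _ _ (chart_domain i) _ _ _
  (@smooth_st_continuous _ _ (chart_domain i) _ (S_chart_smooth i)) Jt Dx e e0.
have near_t : \forall s \near t, `|s - t| < dl.
  by apply/nbhs_ballP; exists dl => // s; rewrite /ball /= distrC.
have near_p : \forall q \near p, chart_dom i q /\ `|chart i q - chart i p| < dl.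
  have /cvgrPdist_lt/(_ _ dl0) hq := chart_continuous_at ip.
  have dq : \forall q \near p, chart_dom i q.
    by apply: open_nbhs_nbhs; split=> //; exact: chart_dom_open.
  by apply: filterS2 dq hq => q iq; rewrite distrC.
exists ([set s | `|s - t| < dl], [set q | chart_dom i q /\ `|chart i q - chart i p| < dl]).
  by split.
move=> [s q] [/= st [iq qp]] [Bs _]; change (`|S_global t p - S_global s q| < e).
rewrite distrC (S_globalE (BJ s Bs) iq) (S_globalE Jt ip).
by apply: h => //; [exact: BJ | exact: chart_img_in].
Qed.

Lemma rescaling_lower_bound t1 (p : M) : `[0, t1] `<=` J -> 0 <= t1 ->
  exists m, forall t, 0 <= t <= t1 -> m <= 2 * (r t / n%:R).
Proof.
move=> sub t1_ge0; pose i := chart_at p; have Dx := chart_img_in (chart_at_dom p).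
have cr : {within `[0, t1], continuous (fun t => 2 * (r t / n%:R))}.
  apply/subspace_continuousP => t tt1; have Jt := sub t tt1.
  apply/cvgrPdist_lt => e e0; rewrite near_withinE.
  have [dl dl0 h] := @st_continuous_eps _ _ (chart_domain i) _ _ _
    (@smooth_st_continuous _ _ (chart_domain i) _ (rescaling_smooth i)) Jt Dx e e0.
  apply/nbhs_ballP; exists dl => //= s; rewrite -ball_normE /ball_ /= distrC => st /sub Js.
  by rewrite distrC; apply: (h s _ Js Dx st); rewrite subrr normr0.
have [|c _ hc] := compact_EVT_min _ (@segment_compact _ 0 t1) cr.
  by exists 0; rewrite /= in_itv /= lexx.
by exists (2 * (r c / n%:R)) => t tt1; apply: hc; rewrite inE /= in_itv.
Qed.

(** The minimum principle for exp (- L t) S.  With m a lower bound of 2 r / n on [0, t1],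
    the constant L = 1 - m makes L + 2 r / n at least 1. *)
Lemma S_global_ge0 t1 : `[0, t1] `<=` J -> 0 <= t1 ->
  (forall p, 0 <= S_global 0 p) -> forall p, 0 <= S_global t1 p.
Proof.
move=> sub t1_ge0 S0 p; have [m hm] := rescaling_lower_bound p sub t1_ge0.
pose L := 1 - m; pose w t q := expR (- L * t) * S_global t q.
have cw : {within `[0, t1] `*` [set: M], continuous (fun z => w z.1 z.2)}.
  have /subspace_continuousP cS := S_global_continuous sub.
  apply/subspace_continuousP => z Bz; apply: cvgM; last exact: cS.
  apply: cvg_within_filter; apply: continuous_comp; last exact: continuous_expR.
  apply: cvgM; first exact: cvg_cst.
  exact: cvg_fst.
have [||[t0 p0] + wmin] := compact_EVT_min _ _ cw.
- by exists (0, p); split; rewrite //= in_itv /= lexx.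
- by apply: compact_setX M_compact; exact: segment_compact.
rewrite inE => -[/= t0t1 _].
have {}wmin t q : t \in `[0, t1] -> w t0 p0 <= w t q.
  by move=> tt1; apply: (wmin (t, q)); rewrite inE; split.
rewrite leNgt; apply/negP => Sneg.
have w0 : w t0 p0 < 0.
  apply: le_lt_trans (wmin t1 p _) _; first by rewrite in_itv /= t1_ge0 lexx.
  by rewrite /w pmulr_rlt0 // expR_gt0.
have St0 : S_global t0 p0 < 0 by move: w0; rewrite /w pmulr_rlt0 // expR_gt0.
have t0_gt0 : 0 < t0.
  have : 0 <= t0 by move: t0t1; rewrite in_itv /= => /andP[].
  rewrite le_eqVlt => /predU1P[t00|//].
  by move: St0; rewrite -t00 ltNge S0.
have Jt0 := sub _ t0t1; have t0le : t0 <= t1 by move: t0t1; rewrite in_itv /= => /andP[].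
pose i := chart_at p0; have ip0 : chart_dom i p0 := chart_at_dom p0.
have Dx0 := chart_img_in ip0; set x0 := chart i p0 in Dx0.
have Sx0 : S_chart i t0 x0 < 0 by rewrite -S_globalE.
have lap : 0 <= laplacian (g i t0) (S_chart i t0) x0.
  apply: (@laplacian_min_ge0 _ _ (chart_domain i) (S_chart i) t0 x0 (g i t0)) => //.
  - exact: S_chart_smooth.
  - exact: metric_is_posdef.
  move=> _ [q iq <-]; rewrite -!S_globalE //.
  by have := wmin t0 q t0t1; rewrite /w ler_pM2l // expR_gt0.
have dtS := @stderivable_has _ _ (chart_domain i) None (S_chart i) t0 x0
  (let: conj _ h := S_chart_smooth i [::] in h None t0 x0 Jt0 Dx0).
have dw := has_tderivM (has_tderiv_expR J L t0) dtS.
have dw_le0 := has_tderiv_left_min dw.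
rewrite /on_line /= in dw_le0.
set l := tderiv J (S_chart i ^~ x0) t0.
(* t0 > 0, so the minimum can be compared with earlier times. *)
have hl : - L * expR (- L * t0) * S_chart i t0 x0 + expR (- L * t0) * l <= 0.
  apply: dw_le0 => dl dl0.
  have m0 : 0 < Num.min dl t0 by rewrite lt_min dl0.
  have [m1 m2] : Num.min dl t0 <= dl /\ Num.min dl t0 <= t0 by rewrite !ge_min !lexx orbT.
  have st1 : t0 - Num.min dl t0 / 2 \in `[0, t1] by rewrite in_itv /=; lra.
  exists (t0 - Num.min dl t0 / 2); first exact: sub.
  split; first lra.
  by have := wmin _ p0 st1; rewrite /w !(@S_globalE i _ p0) //; exact: sub.
have {}hl : l <= L * S_chart i t0 x0.
  have e0 := expR_gt0 (- L * t0).
  rewrite -(ler_pM2l e0) -subr_le0; move: hl; congr (_ <= _); ring.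
have ev := S_chart_evolution Jt0 Dx0; rewrite -/l -/x0 in ev.
have : 0 <= (L + 2 * (r t0 / n%:R)) * S_chart i t0 x0 by lra.
rewrite nmulr_lge0 //; have : m <= 2 * (r t0 / n%:R) by apply: hm; rewrite t0le ltW.
rewrite /L; lra.
Qed.

End Flow.

Theorem theorem1p3 (R : realType) (n : nat) (hn : (0 < n)%N)
    (M : topologicalType) (A : smooth_manifold R n M)
    (M_compact : compact [set: M])
    (alpha : R) (alpha_gt0 : 0 < alpha)
    (J : set R) (J_itv : is_interval J) (J_0 : J 0)
    (J_ge0 : forall t, J t -> 0 <= t)
    (g : metric_family A J) (phi : R -> M -> R)
    (phi_smooth : smooth_scalar_family A J phi)
    (r : R -> R) (flow : rescaled_List_flow alpha r g phi)
    (S_ge0_init : List_scalar_nonneg alpha g phi 0) :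
  forall t, J t -> List_scalar_nonneg alpha g phi t.
Proof.
move=> t Jt; have := J_ge0 t Jt; rewrite le_eqVlt => /predU1P[<- //|t_gt0].
have sub : `[0, t] `<=` J.
  by move=> s; rewrite /= in_itv /=; exact: (J_itv _ _ J_0 Jt).
(* Since 0 < t, the interval J has no isolated point. *)
have J_acc s : J s -> accumulation J s.
  move=> Js e e0; have := J_ge0 s Js; rewrite le_eqVlt => /predU1P[s0|s_gt0].
    have m0 : 0 < Num.min e t by rewrite lt_min e0.
    have [m1 m2] : Num.min e t <= e /\ Num.min e t <= t by rewrite !ge_min !lexx orbT.
    exists (Num.min e t / 2); first by apply: sub; rewrite /= in_itv /=; lra.
    by rewrite -s0 subr0 gtr0_norm ?divr_gt0 // gt_eqF ?divr_gt0 //; lra.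
  have m0 : 0 < Num.min e s by rewrite lt_min e0.
  have [m1 m2] : Num.min e s <= e /\ Num.min e s <= s by rewrite !ge_min !lexx orbT.
  exists (s - Num.min e s / 2); first by apply: (J_itv _ _ J_0 Js); lra.
  split; first by rewrite lt_eqF //; lra.
  by rewrite ltr0_norm; lra.
move=> i p ip.
have := S_globalE hn J_itv J_acc flow Jt ip; rewrite /S_chart => <-.
apply: (S_global_ge0 hn M_compact alpha_gt0 J_itv J_acc phi_smooth flow sub (ltW t_gt0)).
by move=> q; apply: S_ge0_init; exact: chart_at_dom.
Qed.
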